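(* Let $F$ be Lipschitz continuous with density $f$, let $G$ be continuous with finite mean $1/\mu$, and let $\{(\bar{\mathcal R}_a(t),\bar{\mathcal Z}_a(t))\}_{t\ge0}$ (together with $\omega,\bar A,\bar L$) be a fluid model tracking elapsed times, with arrival process $\bar E(t)=\int_0^t\lambda(s)\,ds$, $t\ge0$, as defined in the context. Set $$\lambda(s)=\frac{r(0,-s)}{F^c(-s)}\ \text{ for } s\in(-\omega(0),0),\qquad \bar{\mathcal Z}(0)(C_x)=\int_0^\infty\frac{G^c(s+x)}{G^c(s)}z(0,s)\,ds\ \text{ for }x\ge0 .$$ Then the fluid model is characterized via the same key equation as the fluid model tracking residual times: the total fluid content $\bar X(t)=\bar Q(t)+\bar Z(t)$ satisfies, for all $t\ge0$, $$\bar X(t)=\bar{\mathcal Z}(0)(C_t)+\bar Q(0)G^c(t)+\frac1\mu\int_0^tH_{t-s}\big((\bar X(t-s)-1)^+\big)\,dG_e(s)+\int_0^t(\bar X(t-s)-1)^+\,dG(s),$$ where $H_t$ is built from $F$, $\omega(0)$ and $\lambda$ on $(-\omega(0),\infty)$ as in the context.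
   Context: Notation: $C_x=(x,\infty)$, $a^+=\max(a,0)$, $a\wedge b=\min(a,b)$. $F$ (patience) and $G$ (service) are distribution functions of nonnegative random variables, $F^c=1-F$, $G^c=1-G$, $G_e(x)=\mu\int_0^xG^c(y)\,dy$. $\lambda\ge0$ is a locally integrable arrival rate. Fluid model tracking elapsed times. $\bar{\mathcal R}_a(t)$ and $\bar{\mathcal Z}_a(t)$ are finite measures on $[0,\infty)$: $\bar{\mathcal R}_a(t)([0,x])$ is the amount of fluid in the potential queue (all fluid that has arrived but whose patience has not expired, whether or not it has entered service) with elapsed waiting time at most $x$; $\bar{\mathcal Z}_a(t)([0,x])$ is the amount of fluid in service with elapsed service time at most $x$. Their densities are $r(t,x)=\frac{d}{dx}\bar{\mathcal R}_a(t)([0,x])$ and $z(t,x)=\frac{d}{dx}\bar{\mathcal Z}_a(t)([0,x])$. The function $\omega(t)\ge0$ is the waiting time of the earliest arrived fluid in the physical queue, with $\omega(t)\le t+\omega(0)$, and $$\bar Q(t)=\bar{\mathcal R}_a(t)([0,\omega(t)]),\quad \bar Z(t)=\bar{\mathcal Z}_a(t)([0,\infty)),\quad \bar X(t)=\bar Q(t)+\bar Z(t).$$ The model is required to satisfy, for all $t\ge0$ and $x\ge0$, $$\bar{\mathcal R}_a(t)([0,x])=\int_0^{(x-t)^+}\frac{F^c(s+t)}{F^c(s)}r(0,s)\,ds+\int_{(t-x)^+}^tF^c(t-s)\,d\bar E(s),$$ $$\bar{\mathcal Z}_a(t)([0,x])=\int_0^{(x-t)^+}\frac{G^c(s+t)}{G^c(s)}z(0,s)\,ds+\int_{(t-x)^+}^tG^c(t-s)\,d\bar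 A(s),$$ where $\bar A(s)$ is the amount of fluid that enters service by time $s$; the abandonment process satisfies $$\bar L(t)=\int_0^t\Big(\int_0^{\omega(s)}\frac{f(x)}{1-F(x)}r(s,x)\,dx\Big)ds;$$ the balance equation $\bar Q(t)=\bar Q(0)+\bar E(t)-\bar L(t)-\bar A(t)$ holds; and the non-idling constraints $\bar Q(t)=(\bar X(t)-1)^+$, $\bar Z(t)=\bar X(t)\wedge1$ hold. Definition of $H_t$. For $t\ge0$ and $x\in[0,t+\omega(0)]$ put $$F_t(x)=\int_0^xf(s)\lambda(t-s)\,ds,\qquad F_{d,t}(x)=\int_0^xF^c(s)\lambda(t-s)\,ds,\qquad N_{F,t}=F_{d,t}(t+\omega(0)),$$ $F_{d,t}^{-1}(y)=\inf\{x\ge0:F_{d,t}(x)\ge y\}$ for $y\in[0,N_{F,t}]$, and $$H_t(y)=\begin{cases}\lambda(t)-F_t(F_{d,t}^{-1}(y)),&0\le y<N_{F,t},\\ \lambda(t)-F_t(F_{d,t}^{-1}(N_{F,t})),&y\ge N_{F,t}.\end{cases}$$ *)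

(* Defs.v *)
From HB Require Import structures.
From mathcomp Require Export all_boot all_order all_algebra.
From mathcomp Require Export all_classical all_reals all_analysis.
From mathcomp Require Export measurable_realfun.
Export numFieldNormedType.Exports.

Set Implicit Arguments.
Unset Strict Implicit.
Unset Printing Implicit Defensive.
Import Order.TTheory GRing.Theory Num.Theory.

Local Open Scope classical_set_scope.
Local Open Scope ring_scope.

Local Notation leb := (@lebesgue_measure _).
Local Notation "'dS f" := (lebesgue_stieltjes_measure f)
  (at level 10, f at next level, format "''dS'  f").

Section DistributionFunctions.
Context {R : realType}.
Implicit Types F G f : R -> R.

Definition tail F (x : R) : R := 1 - F x.

Definition nonneg_supported F : Prop := forall x, x < 0 -> F x = 0.

Definition has_pdf F f : Prop :=
  [/\ measurable_fun setT f,
      forall x, 0 <= f x &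
      forall x, (F x)%:E = (\int[leb]_(s in `]-oo, x]) (f s)%:E)%E].

Definition has_mean (G : cumulativeBounded (0 : R) (1 : R)) (m : R) : Prop :=
  (\int['dS G]_(x in [set: R]) x%:E = m%:E)%E.

(* For [x < 0] the interval is empty, so this is the extension of G_e by 0. *)
Definition equilibrium (mu : {posnum R}) (G : cumulativeBounded (0 : R) (1 : R))
    (x : R) : R :=
  mu%:num * (\int[leb]_(y in `[0%R, x]) tail G y)%R.

End DistributionFunctions.

Section EquilibriumCumulative.
Context {R : realType} (mu : {posnum R}) (G : cumulativeBounded (0 : R) (1 : R)).

Let nd_G : {homo (G : R -> R) : x y / x <= y}.
Proof. exact: cumulative_is_nondecreasing. Qed.

Let G_le1 x : G x <= 1.
Proof.
have cG := cumulativey G.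
rewrite -[leRHS](cvg_lim (@Rhausdorff R) cG).
apply: limr_ge; first by apply/cvg_ex; exists 1.
by near=> y; apply: nd_G.
Unshelve. all: by end_near. Qed.

Let G_ge0 x : 0 <= G x.
Proof.
have cG := cumulativeNy G.
rewrite -[leLHS](cvg_lim (@Rhausdorff R) cG).
apply: limr_le; first by apply/cvg_ex; exists 0.
by near=> y; apply: nd_G.
Unshelve. all: by end_near. Qed.

Let measurable_tail (D : set R) : measurable D -> measurable_fun D (tail G).
Proof.
move=> mD; apply: measurable_funB => //.
apply: (@measurable_funS _ _ _ _ setT) => //.
exact: nondecreasing_measurable.
Qed.

Let integrable_tail (a b : R) (i j : bool) :
  leb.-integrable [set` Interval (BSide i a) (BSide j b)] (EFin \o tail G).
Proof.
apply: measurable_bounded_integrable => //.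
- by rewrite /= lebesgue_measure_itv/=; case: ifP => _; rewrite ?ltry// -EFinB ltry.
- exact: measurable_tail.
- exists 1; split; first exact: num_real.
  move=> M M1 x _ /=; rewrite /tail ger0_norm ?subr_ge0//.
  by apply: (le_trans _ (ltW M1)); rewrite gerBl.
Qed.

Let equilibrium_incr (a b : R) : a <= b ->
  0 <= equilibrium mu G b - equilibrium mu G a <= mu%:num * (b - a).
Proof.
move=> ab; rewrite /equilibrium -mulrBr.
suff /andP[h1 h2] : 0 <= (\int[leb]_(y in `[0%R, b]) tail G y)%R
    - (\int[leb]_(y in `[0%R, a]) tail G y)%R <= b - a.
  by rewrite mulr_ge0//= ler_wpM2l.
have key (c d : R) (i : bool) : c <= d ->
    0 <= (\int[leb]_(y in [set` Interval (BSide i c) (BRight d)]) tail G y)%R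
      <= d - c.
  move=> cd; apply/andP; split.
    by apply: Rintegral_ge0 => x _; rewrite /tail subr_ge0.
  apply: (@le_trans _ _ (\int[leb]_(y in [set` Interval (BSide i c) (BRight d)])
      (cst 1) y)%R).
    apply: le_Rintegral => //.
    - apply: measurable_bounded_integrable => //.
        by rewrite /= lebesgue_measure_itv/=; case: ifP => _; rewrite ?ltry// -EFinB ltry.
      by exists 1; split=> // M M1 x _ /=; rewrite normr1 ltW.
    - by move=> x _; rewrite /tail gerBl.
  rewrite Rintegral_cst//= mul1r lebesgue_measure_itv/= lte_fin.
  by case: ifP => //= _; rewrite subr_ge0.
have [a0|a0] := leP 0 a; last first.
  rewrite (set_itv_ge (b1 := BLeft 0) (b2 := BRight a)) ?bnd_simp -?ltNge//.
  rewrite Rintegral_set0 subr0.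
  have [b0|b0] := leP 0 b.
    have /andP[-> /= h] := key 0 b true b0.
    by apply: (le_trans h); rewrite subr0 lerDl oppr_ge0 ltW.
  rewrite set_itv_ge ?bnd_simp -?ltNge//.
  by rewrite Rintegral_set0 lexx subr_ge0.
rewrite (@itv_bndbnd_setU _ _ (BLeft 0) (BRight a) (BRight b)) ?bnd_simp//.
rewrite Rintegral_setU//=.
- by rewrite addrC addKr; exact: key.
- rewrite -itv_bndbnd_setU ?bnd_simp//; exact: integrable_tail.
- apply/disj_setPRL => x/=; rewrite !in_itv/= => /andP[ax _].
  by apply/negP; rewrite negb_and -!ltNge ax orbT.
Qed.

Let nd_equilibrium : {homo equilibrium mu G : x y / x <= y}.
Proof.
by move=> x y xy; rewrite -subr_ge0; have /andP[] := equilibrium_incr xy.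
Qed.

Let rc_equilibrium : right_continuous (equilibrium mu G).
Proof.
apply/right_continuousW => x; apply/cvgrPdist_lt => e e0; near=> y.
have h : `|x - y| < e / mu%:num.
  by near: y; apply: cvgr_dist_lt; rewrite ?divr_gt0//; exact: cvg_id.
have lip (a b : R) : a <= b ->
    `|equilibrium mu G a - equilibrium mu G b| <= mu%:num * `|a - b|.
  move=> ab; rewrite distrC [in leRHS]distrC.
  have /andP[h1 h2] := equilibrium_incr ab.
  by rewrite !ger0_norm// subr_ge0.
apply: (@le_lt_trans _ _ (mu%:num * `|x - y|)).
  have [xy|/ltW xy] := leP x y; first exact: lip.
  by rewrite distrC [in leRHS]distrC; exact: lip.
by rewrite mulrC -ltr_pdivlMr.
Unshelve. all: by end_near. Qed.

HB.instance Definition _ := isCumulative.Build R _ R (equilibrium mu G)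
  nd_equilibrium rc_equilibrium.

End EquilibriumCumulative.

Section FluidModel.
Context {R : realType}.
Local Notation mR := (measurableTypeR R).
Local Notation fmeas := {finite_measure set mR -> \bar R}.

(* "r = d/dx m([0, x])" is read as: r is a Lebesgue density of m on [0, oo). *)
Definition density_of (m : fmeas) (r : R -> R) : Prop :=
  [/\ m `]-oo, 0%R[%classic = 0%E,
      measurable_fun (`[0%R, +oo[%classic : set R) r,
      forall x, 0 <= x -> 0 <= r x &
      forall x, 0 <= x -> m `[0%R, x]%classic = (\int[leb]_(y in `[0%R, x]) (r y)%:E)%E].

Definition Qbar (Ra : R -> fmeas) (omega : R -> R) (t : R) : R :=
  fine (Ra t `[0%R, omega t]%classic).

Definition Zbar (Za : R -> fmeas) (t : R) : R := fine (Za t `[0%R, +oo[%classic).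

Definition Xbar (Ra Za : R -> fmeas) (omega : R -> R) (t : R) : R :=
  Qbar Ra omega t + Zbar Za t.

(* The amount [m t [0, x]] when the initial content has density [m0] in the age,
   inflow is dV and the lifetime distribution function is K.  As x / 0 = 0, no mass survives
   from ages s with tail K s = 0. *)
Definition aged_content (K : R -> R) (m0 : R -> R) (V : cumulative R R)
    (t x : R) : \bar R :=
  (\int[leb]_(s in `[0%R, Num.max (x - t)%R 0%R])
      (tail K (s + t) / tail K s * m0 s)%:E
   + \int['dS V]_(s in `[Num.max (t - x)%R 0%R, t]) (tail K (t - s))%:E)%E.

(* [E] and [A] are functions on the whole line, constantly 0 on (-oo, 0), so that
   dE and dA charge only [0, oo). *)
Record elapsed_fluid_model (F G f : R -> R) (E : cumulative R R)
    (Ra Za : R -> fmeas) (r z : R -> R -> R) (omega : R -> R)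
    (A : cumulative R R) (L : R -> R) : Prop := ElapsedFluidModel {
  efm_r : forall t, 0 <= t -> density_of (Ra t) (r t);
  efm_z : forall t, 0 <= t -> density_of (Za t) (z t);
  efm_omega : forall t, 0 <= t -> 0 <= omega t <= t + omega 0;
  efm_E0 : forall t, t < 0 -> E t = 0;
  efm_A0 : forall t, t < 0 -> A t = 0;
  efm_Ra : forall t x, 0 <= t -> 0 <= x ->
    Ra t `[0%R, x]%classic = aged_content F (r 0) E t x;
  efm_Za : forall t x, 0 <= t -> 0 <= x ->
    Za t `[0%R, x]%classic = aged_content G (z 0) A t x;
  efm_L : forall t, 0 <= t ->
    (L t)%:E = (\int[leb]_(s in `[0%R, t])
      \int[leb]_(x in `[0%R, omega s]) (f x / (1 - F x) * r s x)%:E)%E;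
  efm_balance : forall t, 0 <= t ->
    Qbar Ra omega t = Qbar Ra omega 0 + E t - L t - A t;
  efm_Q : forall t, 0 <= t ->
    Qbar Ra omega t = Num.max (Xbar Ra Za omega t - 1) 0;
  efm_Z : forall t, 0 <= t ->
    Zbar Za t = Num.min (Xbar Ra Za omega t) 1 }.

(* lambda on (-omega0, oo); the value 0 at s <= -omega0 is irrelevant. *)
Definition extended_rate (F : R -> R) (lambda r0 : R -> R) (omega0 s : R) : R :=
  if 0 <= s then lambda s
  else if - omega0 < s then r0 (- s) / tail F (- s) else 0.

(* Z(0)(C_x) *)
Definition initial_residual_service (G z0 : R -> R) (x : R) : \bar R :=
  (\int[leb]_(s in `[0%R, +oo[) (tail G (s + x) / tail G s * z0 s)%:E)%E.

End FluidModel.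

Section KeyFunction.
Context {R : realType}.
Variables (F f lambda : R -> R) (omega0 : R).
Local Open Scope ereal_scope.

Definition F_t (t x : R) : \bar R :=
  \int[leb]_(s in `[0%R, x]) (f s * lambda (t - s))%:E.

Definition Fd_t (t x : R) : \bar R :=
  \int[leb]_(s in `[0%R, x]) (tail F s * lambda (t - s))%:E.

Definition N_t (t : R) : \bar R := Fd_t t (t + omega0)%R.

Definition Fd_t_inv (t : R) (y : \bar R) : R :=
  inf [set x : R | (0 <= x <= t + omega0)%R /\ y <= Fd_t t x].

Definition H_t (t y : R) : \bar R :=
  if y%:E < N_t t then (lambda t)%:E - F_t t (Fd_t_inv t y%:E)
  else (lambda t)%:E - F_t t (Fd_t_inv t (N_t t)).

End KeyFunction.

(* Main.v *)
(** Mass entering service at time s survives to time t with probability 1 - G(t - s),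
    so Z(t) is the residual initial content plus the convolution of dA with the tail
    of G.  Tonelli turns this convolution into A(t) minus the integral of A(t - u) dG(u),
    and the balance equation replaces A by Q(0) + E - L - Q, where
    E - L is absolutely continuous.  The abandonment rate, the integral of the hazard
    rate against the potential queue up to age omega, equals F_t(omega), because the
    potential queue has density F^c(x) lambda(t - x) in the age x.  Finally omega and
    F_(d,t)^(-1)(Q(t)) can differ only across an age interval carrying no fluid, so
    F_t takes the same value at both. *)

(* [omega] carries no measurability assumption, so neither the abandonment intensity nor the queue
   content is known to be a measurable function of time, and Tonelli does not apply to them
   directly. The way round: [L] is monotone whatever its integrand, so Q(0) + E - L - A is
   measurable, and it equals the queue content. The ages below omega(s) can then be replaced by the
   ages whose cumulated content is less than Q(s), a set that varies measurably with s. The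
   replacement drops only a null set of the potential queue, which is the same fact that lets omega
   be exchanged for the generalized inverse in H_t.

   The convolution identities are kept as sums of nonnegative extended reals. The parts into which G
   and its tail split E(t), L(t) and A(t) are finite because these totals are, so subtraction is
   postponed to a point where it is real arithmetic. *)
From HB Require Import structures.
Require Import Defs.
From mathcomp Require Import ring lra unstable.

Import Order.TTheory GRing.Theory Num.Theory.
Local Open Scope classical_set_scope.
Local Open Scope ring_scope.

(** * Integration against a measure given by a density *)

Section MeasureWithDensity.
Local Open Scope ereal_scope.
Context {d} {T : measurableType d} {R : realType}.
Variables (mu : {measure set T -> \bar R}) (v : T -> R).
Hypotheses (v_ge0 : forall x, (0 <= v x)%R) (mv : measurable_fun [set: T] v).

(** The two proofs are arguments so that the measure structure declared below can be inferred from
    the term itself. *)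
Definition with_density (v_ge0 : forall x, (0 <= v x)%R)
  (mv : measurable_fun [set: T] v) (B : set T) : \bar R :=
  \int[mu]_(x in B) (v x)%:E.

Local Notation nu := (with_density v_ge0 mv).

Let with_density0 : nu set0 = 0. Proof. exact: integral_set0. Qed.

Let with_density_ge0 B : 0 <= nu B.
Proof. by apply: integral_ge0 => x _; rewrite lee_fin. Qed.

Let with_density_sigma_additive : semi_sigma_additive nu.
Proof.
move=> /= B mB tB mUB; rewrite /with_density; apply: cvg_toP.
  apply: ereal_nondecreasing_is_cvgn => m n mn.
  by apply: lee_sum_nneg_natr => // k _ _; exact: with_density_ge0.
rewrite ge0_integral_bigcup//=.
- by apply/measurable_funTS/measurable_EFinP.
- by move=> x _; rewrite lee_fin.
Qed.

HB.instance Definition _ := isMeasure.Build _ _ _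
  nu with_density0 with_density_ge0 with_density_sigma_additive.

Import HBNNSimple.

(** For an indicator this is the definition of [nu]; linearity gives simple functions, and monotone
    convergence, applied on both sides, the rest. *)
Lemma ge0_integral_with_density (D : set T) (g : T -> \bar R) :
  measurable D -> measurable_fun D g -> (forall x, D x -> 0 <= g x) ->
  \int[nu]_(x in D) g x = \int[mu]_(x in D) (g x * (v x)%:E).
Proof.
move=> mD mg g0; pose g_ := nnsfun_approx mD mg.
have mvD : measurable_fun D (EFin \o v).
  exact/measurable_funTS/measurable_EFinP.
have mg_ n : measurable_fun D (fun x => (g_ n x)%:E).
  by apply: measurable_funTS; exact/measurable_EFinP.
transitivity (limn (fun n => \int[nu]_(x in D) (g_ n x)%:E)).
  rewrite -monotone_convergence//.
  - apply: eq_integral => x /[!inE] xD; apply/esym/cvg_lim => //.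
    exact: cvg_nnsfun_approx.
  - by move=> n x _; rewrite lee_fin.
  - by move=> x _ m n mn; rewrite lee_fin; exact/lefP/nd_nnsfun_approx.
have -> : (fun n => \int[nu]_(x in D) (g_ n x)%:E) =
    (fun n => \int[mu]_(x in D) ((g_ n x)%:E * (v x)%:E)).
  apply/funext => n.
  transitivity (\sum_(k \in range (g_ n))
      \int[nu]_(x in D) (k * \1_(g_ n @^-1` [set k]) x)%:E).
    under eq_integral do rewrite fimfunE -fsumEFin//.
    rewrite ge0_integral_fsum//.
    - by move=> r; exact/measurable_EFinP/measurable_funM.
    - by move=> r x _; rewrite nnfun_muleindic_ge0.
  transitivity (\sum_(k \in range (g_ n))
      \int[mu]_(x in D) ((k * \1_(g_ n @^-1` [set k]) x)%:E * (v x)%:E)).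
    apply: eq_fsbigr => k _.
    rewrite integralZl_indic_nnsfun// integral_indic//=.
    (* Membership of [k] in the range was dropped, so negative [k] remain to be treated; their
       preimage under [g_ n] is empty. *)
    rewrite /with_density; have [k0|k0] := ltP k 0%R.
      by rewrite preimage_nnfun0// set0I integral_set0 mule0 integral0_eq// => x _;
         rewrite indic0 mulr0 mul0e.
    rewrite setIC integral_mkcondr -ge0_integralZl//.
    - apply: eq_integral => x _; rewrite EFinM -muleA; congr (_ * _).
      by rewrite epatch_indic muleC.
    - apply/measurable_restrict => //.
      exact/measurable_funTS/measurable_EFinP.
    - by move=> x _; rewrite patchE; case: ifPn; rewrite ?lee_fin.
  rewrite -ge0_integral_fsum//.
  - apply: eq_integral => x _; rewrite [in RHS]fimfunE -fsumEFin//.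
    by rewrite ge0_mule_fsuml// => r; rewrite nnfun_muleindic_ge0.
  - move=> r; apply: emeasurable_funM => //.
    exact/measurable_EFinP/measurable_funM.
  - by move=> r x _; rewrite mule_ge0 ?lee_fin// -lee_fin nnfun_muleindic_ge0.
rewrite -monotone_convergence//.
- apply: eq_integral => x /[!inE] xD; apply/cvg_lim => //.
  by apply: cvgeZr => //; exact: cvg_nnsfun_approx.
- by move=> n; apply: emeasurable_funM.
- by move=> n x _; rewrite mule_ge0 ?lee_fin.
- by move=> x _ m n mn; rewrite lee_wpmul2r ?lee_fin//; exact/lefP/nd_nnsfun_approx.
Qed.

End MeasureWithDensity.

(** * Stieltjes measures, densities and reflection on the line *)

Section DensityOnLine.
Context {R : realType}.
Local Notation mR := (measurableTypeR R).
Local Notation leb := (@lebesgue_measure R).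
Local Open Scope ereal_scope.

(** Rays are stable under intersection, generate the Borel sets (a half-open interval is a
    difference of two rays) and exhaust the line with finite mass. *)
Lemma measure_unique_ray (m1 m2 : {measure set mR -> \bar R}) :
  (forall x, m1 `]-oo, x]%classic = m2 `]-oo, x]%classic) ->
  (forall x, m1 `]-oo, x]%classic < +oo) ->
  forall B, measurable B -> m1 B = m2 B.
Proof.
move=> m12 m1oo B mB.
pose rays : set (set mR) := [set C | exists x, C = `]-oo, x]%classic].
have ray_itv : (@measurable _ mR) = <<s rays >>.
  rewrite eqEsubset; split; last first.
    by apply: smallest_sub; [exact: sigma_algebra_measurable|move=> _ [x ->]].
  apply: smallest_sub; first exact: smallest_sigma_algebra.
  move=> _ [[a b] _ <-] /=.
  have -> : `]a, b]%classic = `]-oo, b] `\` `]-oo, a].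
    apply/seteqP; split => x /=; rewrite !in_itv/=.
      by move=> /andP[ax ->]; split => //; apply/negP; rewrite -ltNge.
    by move=> [-> /negP]; rewrite -ltNge andbT.
  have mray x : rays.-sigma.-measurable `]-oo, x]%classic.
    by apply: sub_sigma_algebra; exists x.
  suff : rays.-sigma.-measurable (`]-oo, b]%classic `\` `]-oo, a]%classic) by [].
  exact: measurableD.
apply: (measure_unique rays (fun n => `]-oo, n%:R]%classic)) => //.
- move=> _ _ [x ->] [y ->]; exists (Num.min x y).
  apply/seteqP; split => z/=; rewrite !in_itv/= le_min => /andP//.
- by move=> i; exists i%:R.
- apply/seteqP; split => // x _; exists (Num.bound x) => //=.
  by rewrite in_itv/= ltW// ltr_bound.
- by move=> _ [x ->].
Qed.

Lemma lebesgue_stieltjes_ray (V : cumulative R R) (x : R) :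
  (forall y, (y < 0)%R -> V y = 0%R) ->
  lebesgue_stieltjes_measure V `]-oo, x]%classic = (V x)%:E.
Proof.
move=> V0.
have oc (a b : R) : (a <= b)%R ->
    lebesgue_stieltjes_measure V `]a, b]%classic = (V b - V a)%:E.
  move=> ab; rewrite /lebesgue_stieltjes_measure /measure_extension/=.
  rewrite measurable_mu_extE/=; last exact: is_ocitv.
  by rewrite wlength_itv_bnd.
(* The successor keeps the left end strictly negative, where [V] vanishes; at 0 itself [V] may
   already have jumped. *)
pose I n : set mR := `](- n.+1%:R)%R, x]%classic.
have mI n : measurable (I n) by exact: measurable_itv.
have IE n : lebesgue_stieltjes_measure V (I n) = (V x)%:E.
  rewrite /I; have [nx|xn] := leP (- n.+1%:R)%R x.
    by rewrite oc// (V0 (- n.+1%:R)%R) ?subr0// oppr_lt0.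
  rewrite set_itv_ge ?measure0 ?V0//.
    by rewrite (lt_trans xn)// oppr_lt0.
  by rewrite bnd_simp -leNgt ltW.
have -> : `]-oo, x]%classic = \bigcup_n I n.
  apply/seteqP; split => y /=; last by move=> [n _]; rewrite /I/= !in_itv/= => /andP[].
  rewrite in_itv/= => yx; exists (Num.bound y) => //=.
  rewrite /I/= in_itv/= yx andbT ltrNl.
  by rewrite (lt_trans (ltrNbound y))// ltr_nat.
apply: (@cvg_unique _ _ (lebesgue_stieltjes_measure V (I n) @[n --> \oo])) => //.
  apply: nondecreasing_cvg_mu => //.
    exact: bigcupT_measurable.
  move=> m n mn; apply/subsetPset => y; rewrite /I/= !in_itv/= => /andP[my ->].
  by rewrite andbT (le_lt_trans _ my)// lerN2 ler_nat.
rewrite (_ : (fun n => _) = fun=> (V x)%:E); last by apply/funext => n; exact: IE.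
by apply: cvg_cst.
Qed.

(** Lebesgue measure is its own image under x -> c - x, which is checked on half-open intervals.
    [D'] is given by an equivalence rather than as a preimage, so that an explicit interval can be
    supplied. *)
Lemma lebesgue_reflect (c : R) (D D' : set mR) (g : R -> \bar R) :
  (forall x : R, D' x <-> D (c - x)%R) -> measurable D -> measurable_fun (D : set mR) g -> (forall x, D x -> 0 <= g x) ->
  \int[leb]_(x in D') g (c - x)%R = \int[leb]_(x in D) g x.
Proof.
move=> DD' mD mg g0.
have -> : D' = (fun x : mR => c - x : mR)%R @^-1` D.
  by apply/seteqP; split => x /DD'.
have mc : measurable_fun [set: mR] ((fun x => c - x)%R : mR -> mR).
  by apply: measurable_funB => //; exact: measurable_cst.
have h0 : {in D, forall y, 0 <= g y} by move=> y /[!inE]; exact: g0.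
have := @ge0_integral_pushforward _ _ _ _ _ _ mc leb D g mD mg h0.
rewrite /comp => <-; apply: eq_measure_integral => A mA _.
apply/esym/lebesgue_measure_unique => //= _ [[a b]] _ <-.
have cE : (fun x : mR => c - x)%R @^-1` `]a, b]%classic = `[(c - b)%R, (c - a)%R[%classic.
  apply/seteqP; split => y /=; rewrite !in_itv/=; lra.
rewrite /pushforward/= cE !lebesgue_measure_itv/= !lte_fin ltrD2l ltrN2.
by case: ifP => // _; rewrite -!EFinD; congr (_%:E); ring.
Qed.

Lemma integral_density (m : {measure set mR -> \bar R}) (v : R -> R)
  (D : set mR) (g : R -> \bar R) :
  (forall x, 0 <= v x)%R -> measurable_fun [set: mR] v ->
  (forall x, m `]-oo, x]%classic = \int[leb]_(y in `]-oo, x]) (v y)%:E) ->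
  (forall x, m `]-oo, x]%classic < +oo) ->
  measurable D -> measurable_fun (D : set mR) g -> (forall x, D x -> 0 <= g x) ->
  \int[m]_(x in D) g x = \int[leb]_(x in D) (g x * (v x)%:E).
Proof.
move=> v0 mv mE moo mD mg g0.
rewrite -(ge0_integral_with_density leb v v0 mv)//.
apply: eq_measure_integral => B mB _.
by apply: measure_unique_ray => // x; rewrite mE.
Qed.

End DensityOnLine.

(** * Measures carried by the half-line, and convolution *)

Section HalfLine.
Context {R : realType}.
Local Notation mR := (measurableTypeR R).
Local Notation leb := (@lebesgue_measure R).
Local Open Scope ereal_scope.

Lemma lebesgue_stieltjes_neg (V : cumulative R R) :
  (forall y, (y < 0)%R -> V y = 0%R) ->
  lebesgue_stieltjes_measure V `]-oo, 0%R[%classic = 0.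
Proof.
move=> V0; apply/eqP; rewrite -measure_le0.
(* The closed rays stop short of 0, because [V] may have an atom there. *)
have -> : `]-oo, 0%R[%classic = \bigcup_n `]-oo, (- n.+1%:R^-1)%R]%classic :> set mR.
  apply/seteqP; split => x /=; rewrite in_itv/=.
    rewrite -oppr_gt0 => x0; exists (Num.bound (- x)^-1) => //=.
    rewrite in_itv/= lerNr invf_ple ?posrE// ltW//.
    by rewrite (lt_trans (ltr_bound _))// ltr_nat.
  move=> [n _] /=; rewrite in_itv/= => /le_lt_trans; apply.
  by rewrite oppr_lt0 invr_gt0.
pose I n : set mR := `]-oo, (- n.+1%:R^-1)%R]%classic.
have mI n : measurable (I n) by exact: measurable_itv.
have mUI : measurable (\bigcup_n I n) by exact: bigcupT_measurable.
have := generalized_Boole_inequality (lebesgue_stieltjes_measure V) mI mUI.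
move=> /le_trans; apply.
rewrite eseries0// => n _ _.
apply: (eq_trans (lebesgue_stieltjes_ray V _ V0)).
by rewrite V0// oppr_lt0 invr_gt0.
Qed.

Lemma lebesgue_stieltjes_itv0 (V : cumulative R R) (x : R) :
  (forall y, (y < 0)%R -> V y = 0%R) -> (0 <= x)%R ->
  lebesgue_stieltjes_measure V `[0%R, x]%classic = (V x)%:E.
Proof.
move=> V0 x0; rewrite -lebesgue_stieltjes_ray//.
rewrite (@itv_bndbnd_setU _ _ -oo%O (BLeft 0%R) (BRight x)) ?bnd_simp//.
rewrite measureU//; try exact: measurable_itv.
- by rewrite [X in X + _](lebesgue_stieltjes_neg V V0) add0e.
- apply/seteqP; split => // y [] /=; rewrite !in_itv/= => y0 /andP[].
  by rewrite leNgt y0.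
Qed.

Lemma integral_half_line_density (m : {measure set mR -> \bar R}) (v : R -> R)
  (D : set mR) (g : R -> \bar R) :
  m `]-oo, 0%R[%classic = 0 ->
  (forall x, 0 <= x -> 0 <= v x)%R ->
  measurable_fun (`[0%R, +oo[%classic : set mR) v ->
  (forall x, (0 <= x)%R ->
    m `[0%R, x]%classic = \int[leb]_(y in `[0%R, x]) (v y)%:E) ->
  (forall x, (0 <= x)%R -> m `[0%R, x]%classic < +oo) ->
  measurable D -> D `<=` `[0%R, +oo[%classic ->
  measurable_fun (D : set mR) g -> (forall x, D x -> 0 <= g x) ->
  \int[m]_(x in D) g x = \int[leb]_(x in D) (g x * (v x)%:E).
Proof.
move=> m0 v0 mv mE moo mD D0 mg g0.
(* Nothing is known of [v] at negative arguments; extending it by 0 gives a density on the whole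
   line, where rays determine the measure. *)
pose v' := v \_ `[0%R, +oo[%classic.
have v'0 x : (0 <= v' x)%R.
  by rewrite /v' patchE; case: ifPn => //; rewrite inE/= in_itv/= andbT => /v0.
have mv' : measurable_fun [set: mR] v'.
  have mH : measurable (`[0%R, +oo[%classic : set mR) by exact: measurable_itv.
  exact/(measurable_restrictT v mH).
have v'E x : (0 <= x)%R -> v' x = v x.
  by move=> x0; rewrite /v' patchE mem_set//= in_itv/= x0.
have v'N x : (x < 0)%R -> v' x = 0%R.
  by move=> x0; rewrite /v' patchE memNset//= in_itv/= andbT; apply/negP; rewrite -ltNge.
have rayU x : (0 <= x)%R -> 
    `]-oo, x]%classic = `]-oo, (0 : R)%R[%classic `|` `[(0 : R)%R, x]%classic.
  by move=> x0; rewrite (@itv_bndbnd_setU _ _ -oo%O (BLeft 0%R) (BRight x)) ?bnd_simp.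
have rayI x : [disjoint `]-oo, (0 : R)%R[%classic & `[(0 : R)%R, x]%classic].
  apply/disj_setPS => y [] /=; rewrite !in_itv/= => y0 /andP[].
  by rewrite leNgt y0.
have mray x : m `]-oo, x]%classic = if (0 <= x)%R then m `[0%R, x]%classic else 0.
  case: ifPn => [x0|]; last first.
    rewrite -ltNge => x0; apply/eqP; rewrite -measure_le0 -m0.
    apply: le_measure; rewrite ?inE//; try exact: measurable_itv.
    by move=> y /=; rewrite !in_itv/= => /le_lt_trans; exact.
  rewrite rayU// measureU//; try exact: measurable_itv.
  - by rewrite [X in X + _]m0 add0e.
  - exact/disj_set2P/rayI.
rewrite (@integral_density _ _ v')//.
- apply: eq_integral => x /[!inE] /D0 /=; rewrite in_itv/= andbT => x0.
  by rewrite v'E.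
- move=> x; rewrite mray; case: ifPn => [x0|]; last first.
    rewrite -ltNge => x0; rewrite integral0_eq// => y /=; rewrite in_itv/= => yx.
    by rewrite v'N// (le_lt_trans yx).
  rewrite mE// rayU// ge0_integral_setU//; first last.
  - by move=> y _; rewrite lee_fin.
  - exact/measurable_funTS/measurable_EFinP.
  rewrite [X in _ = X + _]integral0_eq ?add0e; last first.
    by move=> y /=; rewrite in_itv/= => y0; rewrite v'N.
  by apply: eq_integral => y /[!inE]/=; rewrite in_itv/= => /andP[y0 _]; rewrite v'E.
- by move=> x; rewrite mray; case: ifP => //; exact: moo.
Qed.

(** Both sides integrate k(s) against dG(u) x dnu(s) over the triangle u >= 0, s >= 0, u + s <= t;
    for fixed s the dG-mass of the section [0, t - s] is G(t - s), an atom at 0 included. *)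
Lemma convolution_tonelli (nu : {sigma_finite_measure set mR -> \bar R})
  (G : cumulative R R) (k : R -> \bar R) (t : R) :
  (forall y, (y < 0)%R -> G y = 0%R) -> (forall s, 0 <= k s) ->
  measurable_fun [set: mR] k -> (0 <= t)%R ->
  \int[lebesgue_stieltjes_measure G]_(u in `[0%R, t])
      \int[nu]_(s in `[0%R, (t - u)%R]) k s =
  \int[nu]_(s in `[0%R, t]) (k s * (G (t - s)%R)%:E).
Proof.
move=> G0 k0 mk t0.
pose S : set (mR * mR) := [set p | [/\ (0 <= p.1)%R, (0 <= p.2)%R & (p.1 + p.2 <= t)%R]].
have mS : measurable S.
  have -> : S = (fun p : mR * mR => (0 : R) <= (p.1 : R))%R @^-1` [set true] `&`
      (fun p : mR * mR => (0 : R) <= (p.2 : R))%R @^-1` [set true] `&`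
      (fun p : mR * mR => (p.1 : R) + (p.2 : R) <= t)%R @^-1` [set true].
    by apply/seteqP; split => p /=; [move=> [-> -> ->]|move=> [[]]].
  have m1 : measurable_fun [set: mR * mR] (fun p : mR * mR => p.1 : R) by exact: measurable_fst.
  have m2 : measurable_fun [set: mR * mR] (fun p : mR * mR => p.2 : R) by exact: measurable_snd.
  apply: measurableI; first apply: measurableI.
  - by rewrite -[X in measurable X]setTI; apply: measurable_fun_ler.
  - by rewrite -[X in measurable X]setTI; apply: measurable_fun_ler.
  - by rewrite -[X in measurable X]setTI; apply: measurable_fun_ler => //; exact: measurable_funD.
pose f (p : mR * mR) : \bar R := k p.2 * (\1_S p)%:E.
have f0 p : 0 <= f p by rewrite mule_ge0.
have mf : measurable_fun [set: mR * mR] f.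
  apply: emeasurable_funM; first exact: measurableT_comp.
  by apply/measurable_EFinP; exact: measurable_indic.
have mI (i : interval R) : measurable ([set` i] : set mR) by exact: measurable_itv.
have := @fubini_tonelli _ _ _ _ _ (lebesgue_stieltjes_measure G) nu f mf f0.
rewrite /fubini_F /fubini_G => FG.
transitivity (\int[lebesgue_stieltjes_measure G]_u \int[nu]_s f (u, s)).
  rewrite integral_mkcond; apply: eq_integral => u _; rewrite patchE.
  case: ifPn; rewrite ?notin_setE ?inE/= in_itv/=; [move=> /andP[u0 ut]|move=> uN].
    rewrite integral_mkcond epatch_indic.
    apply: eq_integral => s _; rewrite /f/=; congr (_ * _%:E).
    rewrite !indicE; congr (nat_of_bool _)%:R; apply/idP/idP => /[!inE]/=; rewrite in_itv/=.
      by move=> /andP[s0 st]; split => //=; rewrite addrC -lerBrDr.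
    by move=> [_ /= -> ust]; rewrite lerBrDr addrC.
  apply/esym; apply: integral0_eq => s _; rewrite /f indicE memNset ?mule0//.
  move=> [/= u0 s0 ust]; apply: uN; rewrite u0/=.
  by rewrite (le_trans _ ust)// lerDl.
rewrite FG [RHS]integral_mkcond; apply: eq_integral => s _; rewrite patchE.
case: ifPn; rewrite ?notin_setE ?inE/= in_itv/=; [move=> /andP[s0 st]|move=> sN].
  rewrite /f/= ge0_integralZl//; last first.
    apply/measurable_EFinP.
    have mS1 : measurable_fun [set: mR * mR] (\1_S : _ -> R) by exact: measurable_indic.
    exact: (measurable_fun_pair1 s mS1).
  congr (_ * _); rewrite -(lebesgue_stieltjes_itv0 _ _ G0) ?subr_ge0//.
  rewrite -[in RHS](setIT `[0%R, (t - s)%R]%classic) -integral_indic//.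
  apply: eq_integral => u _; congr (_%:E).
  rewrite !indicE; congr (nat_of_bool _)%:R; apply/idP/idP => /[!inE]/=; rewrite in_itv/=.
    by move=> [/= -> _ ust]; rewrite lerBrDr.
  by move=> /andP[u0 ust]; split => //=; rewrite -lerBrDr.
apply: integral0_eq => u _; rewrite /f indicE memNset ?mule0//.
move=> [/= u0 s0 ust]; apply: sN; rewrite s0/=.
by rewrite (le_trans _ ust)// lerDr.
Qed.

End HalfLine.

(** * Null tails and the hazard rate *)

Section Tails.
Context {R : realType}.
Local Notation mR := (measurableTypeR R).
Local Notation leb := (@lebesgue_measure R).
Local Open Scope ereal_scope.

(* C is an up-set, and the rays ]q, +oo[ with q rational in C cover it up to its minimum. *)
Lemma atomless_null_tail (nu : {measure set mR -> \bar R}) :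
  (forall x, nu [set x] = 0) ->
  let C := [set x : mR | nu `](x : R), +oo[%classic = 0] in
  measurable C /\ nu C = 0.
Proof.
move=> nu0 C.
have mI (i : interval R) : measurable ([set` i] : set mR) by exact: measurable_itv.
have Cup (x y : R) : C x -> (x <= y)%R -> C y.
  rewrite /C/= => x0 xy; apply/eqP; rewrite -measure_le0 -x0.
  by apply: le_measure; rewrite ?inE// => z /=; rewrite !in_itv/= !andbT; exact: le_lt_trans.
have mC : measurable C.
  apply: is_interval_measurable => x y Cx _ z /andP[xz _].
  exact: Cup xz.
split => //; apply/negligibleP => //.
pose B n : set mR := if unpickle n is Some q then
    (if `[< C (ratr q) >] then `](ratr q : R), +oo[%classic else set0) else set0.
pose M : set mR := [set x | C x /\ forall y, C y -> (x <= y :> R)%R].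
apply: (@negligibleS _ _ _ nu (\bigcup_n B n `|` M)).
  move=> x Cx; have [|/existsNP[y /not_implyP[Cy /negP]]] := pselect (forall y, C y -> (x <= y :> R)%R).
    by right.
  rewrite -ltNge => yx; left; have [q] := rat_in_itvoo yx.
  rewrite in_itv/= => /andP[yq qx]; exists (pickle q); first exact: Logic.I.
  rewrite /B pickleK; case: asboolP => [_|]; first by rewrite /= in_itv/= qx.
  by case; exact: Cup (ltW yq).
apply: negligibleU.
  apply: negligible_bigcup => n; rewrite /B.
  case: unpickle => [q|]; last exact: negligible_set0.
  case: asboolP => [Cq|_]; last exact: negligible_set0.
  exact/negligibleP.
have [->|/set0P[x [Cx xM]]] := eqVneq M set0; first exact: negligible_set0.
apply: (@negligibleS _ _ _ nu [set x]).
  by move=> y [Cy yM] /=; apply/eqP; rewrite eq_le yM// xM.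
by apply/negligibleP; [exact: (measurable_set1 (x : R))|exact: (nu0 (x : R))].
Qed.

Variable F : cumulativeBounded (0 : R) (1 : R).

Lemma cumulative_bounds x : (0 <= F x <= 1)%R.
Proof.
by rewrite -!lee_fin -!(cdf_lebesgue_stieltjes_id F x) cdf_ge0 cdf_le1.
Qed.

Lemma tail_ge0 x : (0 <= tail F x)%R.
Proof. by rewrite subr_ge0; have /andP[] := cumulative_bounds x. Qed.

Lemma measurable_cdf : measurable_fun [set: mR] (F : R -> R).
Proof. by apply: nondecreasing_measurable => // x y; exact: cumulative_is_nondecreasing. Qed.

Lemma measurable_tail : measurable_fun [set: mR] (tail F).
Proof. by apply: measurable_funB => //; exact: measurable_cdf. Qed.

(** The real power -1 agrees with the inverse on nonnegative reals, the default value at 0 included,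
    and powers are measurable. *)
Lemma measurable_tailV : measurable_fun [set: mR] (fun x => (tail F x)^-1)%R.
Proof.
have := measurableT_comp (measurable_powR (-1 : R)%R) measurable_tail.
by apply: eq_measurable_fun => x _ /=; rewrite powR_inv1// tail_ge0.
Qed.

Variable f : R -> R.
Hypothesis Ff : has_pdf F f.

(* f vanishes almost everywhere on {F = 1}, so the junk value
   f / 0 = 0 of the hazard rate there is harmless. *)
Lemma integral_hazard (D : set mR) (g : R -> \bar R) :
  measurable D -> measurable_fun D g -> (forall x, D x -> 0 <= g x) ->
  \int[leb]_(x in D) ((f x)%:E * g x) =
  \int[leb]_(x in D) ((f x / tail F x)%:E * ((tail F x)%:E * g x)).
Proof.
move=> mD mg g0; case: Ff => mf f0 FE.
have ray x : lebesgue_stieltjes_measure F `]-oo, x]%classic = (F x)%:E.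
  exact: cdf_lebesgue_stieltjes_id.
have dFE (D' : set mR) (h : R -> \bar R) : measurable D' -> measurable_fun D' h ->
    (forall x, D' x -> 0 <= h x) ->
    \int[lebesgue_stieltjes_measure F]_(x in D') h x = \int[leb]_(x in D') (h x * (f x)%:E).
  move=> mD' mh h0; apply: integral_density => //.
    by move=> x; rewrite -FE; exact: ray.
  by move=> x; rewrite [X in X < _]ray ltry.
have mI (i : interval R) : measurable ([set` i] : set mR) by exact: measurable_itv.
have atomless x : lebesgue_stieltjes_measure F [set x] = 0.
  have m1 : measurable ([set x] : set mR) by exact: measurable_set1.
  have := dFE [set x] (cst 1) m1 (measurable_cst _) (fun _ _ => lee01).
  by rewrite integral_cst// mul1e => ->; rewrite integral_set1.
have [mC C0] := atomless_null_tail _ atomless.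
have CE x : lebesgue_stieltjes_measure F `]x, +oo[%classic = (tail F x)%:E.
  by rewrite -setCitvl probability_setC// [X in _ - X]ray.
set C := (X in measurable X) in mC C0.
have tailC x : (x \in C) = (tail F x == 0%R).
  apply/idP/eqP => xC; first by move: xC; rewrite inE /C/= CE => -[].
  by rewrite inE /C/= CE xC.
(* Against dF the set [C] where [tail F] vanishes has measure 0 and can be removed; off [C] the
   division is genuine, and on [C] the right-hand integrand is 0 by default. *)
transitivity (\int[lebesgue_stieltjes_measure F]_(x in D) g x).
  by rewrite dFE//; apply: eq_integral => x _; rewrite muleC.
rewrite (ge0_negligible_integral mC mD mg g0 C0).
have mDC : measurable (D `\` C) by exact: measurableD.
rewrite dFE//; last 2 first.
- exact: measurable_funS mg.
- by move=> x [Dx _]; exact: g0.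
rewrite setDE integral_mkcondr; apply: eq_integral => x _.
rewrite patchE in_setC tailC; case: eqVneq => [->|Fx0] /=.
  by rewrite invr0 mulr0 mul0e.
by rewrite muleA -EFinM divfK// muleC.
Qed.

End Tails.

(** * The age density of the potential queue *)

Section AgedContent.
Context {R : realType}.
Local Notation mR := (measurableTypeR R).
Local Notation leb := (@lebesgue_measure R).
Local Notation fmeas := {finite_measure set mR -> \bar R}.
Local Open Scope ereal_scope.

Lemma density_of_integral (m : fmeas) (v : R -> R) (D : set mR) (g : R -> \bar R) :
  density_of m v -> measurable D -> D `<=` `[0%R, +oo[%classic ->
  measurable_fun (D : set mR) g -> (forall x, D x -> 0 <= g x) ->
  \int[m]_(x in D) g x = \int[leb]_(x in D) (g x * (v x)%:E).
Proof.
move=> [m0 mv v0 mE] mD D0 mg g0.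
apply: integral_half_line_density => // x x0.
by rewrite -ge0_fin_numE// fin_num_measure//; exact: measurable_itv.
Qed.

Variable F : cumulativeBounded (0 : R) (1 : R).
Variables (lambda r0 : R -> R) (omega0 : R).
Hypothesis lambda_ge0 : forall s : R, (0 <= s -> 0 <= lambda s)%R.
Hypothesis lambda_locint : forall t : R, (0 <= t)%R ->
     lebesgue_measure.-integrable `[0%R, t] (EFin \o lambda).
Hypothesis r0_ge0 : forall s : R, (0 <= s -> 0 <= r0 s)%R.
Hypothesis mr0 : measurable_fun (`[0%R, +oo[%classic : set mR) r0.

Lemma measurable_rate : measurable_fun (`[0%R, +oo[%classic : set mR) lambda.
Proof.
have -> : `[0%R, +oo[%classic = \bigcup_n `[0%R, (n%:R : R)]%classic :> set mR.
  apply/seteqP; split => x /=; rewrite in_itv/= ?andbT.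
    by move=> x0; exists (Num.bound x) => //=; rewrite in_itv/= x0 ltW// ltr_bound.
  by move=> [n _] /=; rewrite in_itv/= => /andP[].
apply/measurable_fun_bigcup => n; first exact: measurable_itv.
by have /measurable_int/measurable_EFinP := lambda_locint n%:R (ler0n _ _).
Qed.

Lemma measurable_half_line (g : R -> R) :
  measurable_fun (`[0%R, +oo[%classic : set mR) g ->
  measurable_fun [set: mR] (g \_ `[0%R, +oo[%classic).
Proof.
have mH : measurable (`[0%R, +oo[%classic : set mR) by exact: measurable_itv.
by move=> mg; exact/(measurable_restrictT g mH).
Qed.

(* Without the cut-off of extended_rate at - omega0, so that
   tail F u * uncut_rate (t - u) is the age density on all of [0, +oo[. *)
Definition uncut_rate (s : R) : R :=
  (if 0 <= s then lambda s else r0 (- s) / tail F (- s))%R.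

Lemma uncut_rate_ge0 s : (0 <= uncut_rate s)%R.
Proof.
rewrite /uncut_rate; case: ifPn => [/lambda_ge0//|]; rewrite -ltNge => s0.
by rewrite divr_ge0 ?tail_ge0// r0_ge0// oppr_ge0 ltW.
Qed.

Lemma measurable_uncut_rate : measurable_fun [set: mR] uncut_rate.
Proof.
have halfE (g : R -> R) s : (0 <= s)%R -> (g \_ `[0%R, +oo[%classic) s = g s.
  by move=> s0; rewrite patchE mem_set//= in_itv/= s0.
pose g (s : mR) : R := if (0 <= (s : R))%R then (lambda \_ `[0%R, +oo[%classic) s
  else ((r0 \_ `[0%R, +oo[%classic) (- s) * (tail F (- s))^-1)%R.
have mN : measurable_fun [set: mR] (fun s : mR => - (s : R))%R by exact: oppr_measurable.
have mg : measurable_fun [set: mR] g.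
  apply: measurable_fun_ifT; first by apply: measurable_fun_ler.
  apply: measurable_half_line; exact: measurable_rate.
  apply: measurable_funM; last exact: measurableT_comp (measurable_tailV F) mN.
  exact: measurableT_comp (measurable_half_line _ mr0) mN.
apply: eq_measurable_fun mg => s _; rewrite /g /uncut_rate.
case: ifPn => [s0|]; first by rewrite halfE.
by rewrite -ltNge => s0; rewrite halfE// oppr_ge0 ltW.
Qed.

Lemma extended_rateE s :
  extended_rate F lambda r0 omega0 s = if (0 <= s)%R || (- omega0 < s)%R then uncut_rate s else 0%R.
Proof. by rewrite /extended_rate /uncut_rate; case: ifP. Qed.

Lemma extended_rate_ge0 s : (0 <= extended_rate F lambda r0 omega0 s)%R.
Proof. by rewrite extended_rateE; case: ifP => // _; exact: uncut_rate_ge0. Qed.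

Lemma measurable_extended_rate :
  measurable_fun [set: mR] (extended_rate F lambda r0 omega0).
Proof.
apply: (eq_measurable_fun (fun s : mR => if (0 <= (s : R))%R then uncut_rate s else
    if (- omega0 < (s : R))%R then uncut_rate s else 0%R)).
  by move=> s _; rewrite extended_rateE; case: ifP.
have mu := measurable_uncut_rate.
apply: measurable_fun_ifT => //; first by apply: measurable_fun_ler.
by apply: measurable_fun_ifT => //; apply: measurable_fun_ltr.
Qed.

Variable E : cumulative R R.
Hypothesis E0 : forall t, (t < 0)%R -> E t = 0%R.
Hypothesis E_lambda : forall t : R,
     (E t)%:E = \int[leb]_(s in `[0%R, t]) (lambda s)%:E.

(** Initial fluid of age s is treated as an arrival at time -s with rate r0(s) / F^c(s). The two
    integrals then become one integral over arrival times from t - x to t, and reflection turns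
    arrival times into ages. *)
Lemma aged_contentE (t x : R) : (0 <= t)%R -> (0 <= x)%R ->
  aged_content F r0 E t x =
  \int[leb]_(u in `[0%R, x]) (tail F u * uncut_rate (t - u))%:E.
Proof.
move=> t0 x0; rewrite /aged_content.
have mI (i : interval R) : measurable ([set` i] : set mR) by exact: measurable_itv.
pose g (s : R) : \bar R := (tail F (t - s) * uncut_rate s)%:E.
have mts : measurable_fun [set: mR] (fun s : mR => t - (s : R))%R.
  by apply: measurable_funB => //; exact: measurable_cst.
have mg : measurable_fun [set: mR] g.
  apply/measurable_EFinP; apply: measurable_funM; last exact: measurable_uncut_rate.
  exact: measurableT_comp (measurable_tail F) mts.
have g0 s : 0 <= g s by rewrite lee_fin mulr_ge0 ?tail_ge0 ?uncut_rate_ge0.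
have mgD (D : set mR) : measurable_fun D g by exact: measurable_funTS.
have EE (a : R) : (0 <= a)%R -> \int[lebesgue_stieltjes_measure E]_(s in `[a, t]) (tail F (t - s))%:E
    = \int[leb]_(s in `[a, t]) g s.
  move=> a0; rewrite (@integral_half_line_density _ _ lambda)//; first last.
  - by move=> s _; rewrite lee_fin tail_ge0.
  - apply/measurable_EFinP/measurable_funTS.
    exact: measurableT_comp (measurable_tail F) mts.
  - by move=> s /=; rewrite !in_itv/= andbT => /andP[+ _]; exact: le_trans.
  - by move=> y y0; rewrite [X in X < _]lebesgue_stieltjes_itv0// ltry.
  - by move=> y y0; rewrite [LHS]lebesgue_stieltjes_itv0// E_lambda.
  - exact: measurable_rate.
  - exact: lebesgue_stieltjes_neg.
  apply: eq_integral => s /[!inE]/=; rewrite in_itv/= => /andP[/(le_trans a0) s0 _].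
  by rewrite /g /uncut_rate s0.
rewrite EE ?le_max ?lexx ?orbT//.
have -> : \int[leb]_(s in `[0%R, Num.max (x - t)%R 0%R]) (tail F (s + t) / tail F s * r0 s)%:E
    = \int[leb]_(s in `[(- Num.max (x - t) 0)%R, 0%R[) g s.
  set b := Num.max _ _; have b0 : (0 <= b)%R by rewrite le_max lexx orbT.
  (* Age 0 is dropped: at time 0 the value of [uncut_rate] is that of [lambda], not the quotient
     with [r0]. *)
  rewrite -integral_itv_obnd_cbnd; last first.
    have mst : measurable_fun [set: mR] (fun s : mR => (s : R) + t)%R.
      by apply: measurable_funD => //; exact: measurable_cst.
    apply/measurable_EFinP; apply: measurable_funM; last first.
      apply: measurable_funS mr0; first exact: mI.
      by move=> s /=; rewrite !in_itv/= andbT => /andP[/ltW].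
    apply/measurable_funTS/measurable_funM; last exact: measurable_tailV.
    exact: measurableT_comp (measurable_tail F) mst.
  rewrite -(@lebesgue_reflect _ 0%R (`[(- b)%R, 0%R[%classic : set R) (`]0%R, b]%classic : set R) g)//; last first.
    by move=> y /=; rewrite !in_itv/=; split; lra.
  apply: eq_integral => y /[!inE]/=; rewrite in_itv/= => /andP[y0 _].
  rewrite /g /uncut_rate sub0r oppr_ge0 leNgt y0/= !opprK.
  by congr (_%:E); rewrite addrC mulrAC mulrA.
have -> : \int[leb]_(s in `[(- Num.max (x - t) 0)%R, 0%R[) g s +
    \int[leb]_(s in `[Num.max (t - x)%R 0%R, t]) g s = \int[leb]_(s in `[(t - x)%R, t]) g s.
  have [xt|/ltW tx] := leP x t.
    rewrite (max_r (_ : (x - t <= 0)%R)) ?subr_le0// oppr0 set_itvco0 integral_set0 add0e.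
    by rewrite max_l// subr_ge0.
  rewrite (max_l (_ : (0 <= x - t)%R)) ?subr_ge0// max_r ?subr_le0// opprB.
  rewrite [in RHS](@itv_bndbnd_setU _ _ (BLeft (t - x)%R) (BLeft 0%R) (BRight t)) ?bnd_simp ?subr_le0//.
  rewrite ge0_integral_setU//.
  apply/disj_setPS => y [] /=; rewrite !in_itv/= => /andP[_ y0] /andP[].
  by rewrite leNgt y0.
rewrite -(@lebesgue_reflect _ t (`[(t - x)%R, t]%classic : set R) (`[0%R, x]%classic : set R) g)//; last first.
  by move=> y /=; rewrite !in_itv/=; split; lra.
by apply: eq_integral => u _; rewrite /g subKr.
Qed.

End AgedContent.

(** * The abandonment flow and the function H_t *)

Section Outflow.
Context {R : realType}.
Local Notation mR := (measurableTypeR R).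
Local Notation leb := (@lebesgue_measure R).
Local Notation fmeas := {finite_measure set mR -> \bar R}.
Local Open Scope ereal_scope.

(** What [D] misses of [0, w] consists of points x with m(]x, w]) = 0, and for an atomless m these
    form a null set. Leaving [D] free covers both the interval up to the generalized inverse and the
    level set in [abandonment_rate]. *)
Lemma integral_level_set (m : fmeas) (h : R -> \bar R) (w : R) (D : set mR) :
  (forall x, m [set x] = 0) -> measurable D -> D `<=` `[0%R, w]%classic ->
  (forall x : R, (0 <= x <= w)%R -> m `[0%R, x]%classic < m `[0%R, w]%classic -> D x) ->
  measurable_fun (`[0%R, w]%classic : set mR) h ->
  (forall x : R, (0 <= x <= w)%R -> 0 <= h x) ->
  \int[m]_(x in D) h x = \int[m]_(x in `[0%R, w]) h x.
Proof.
move=> m0 mD Dw wD mh h0.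
have mI (i : interval R) : measurable ([set` i] : set mR) by exact: measurable_itv.
have mW : measurable (`[(0 : R)%R, w]%classic : set mR) by exact: mI.
(* Restricting m to [0, w] makes the unbounded tails of [atomless_null_tail] into the intervals ]x,
   w]. *)
pose nu := mrestr m mW.
have nu0 x : nu [set x] = 0.
  have m1 : measurable ([set x] : set mR) by exact: (measurable_set1 (x : R)).
  apply/eqP; rewrite -measure_le0 -(m0 x); apply: le_measure; rewrite ?inE//.
  exact: measurableI.
have [mC C0] := atomless_null_tail nu nu0.
set C := (X in measurable X) in mC C0.
pose N : set mR := C `&` `[(0 : R)%R, w]%classic.
have mN : measurable N by exact: measurableI.
have N0 : m N = 0 by exact: C0.
have h0W x : (`[(0 : R)%R, w]%classic : set mR) x -> 0 <= h x.
  by move=> /=; rewrite in_itv/=; exact: h0.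
have h0D x : D x -> 0 <= h x by move=> /Dw; exact: h0W.
rewrite [RHS](ge0_negligible_integral mN mW mh h0W N0).
rewrite (ge0_negligible_integral mN mD (measurable_funS mW Dw mh) h0D N0).
congr integral; apply/seteqP; split => x [xD xN]; split => //; first exact: Dw.
have xw : (0 <= (x : R) <= w)%R by move: xD; rewrite /= in_itv.
apply: wD => //; rewrite lt_neqAle; apply/andP; split; last first.
  apply: le_measure; rewrite ?inE//.
  by move=> y /=; rewrite !in_itv/= => /andP[-> /le_trans]; apply; case/andP: xw.
apply/eqP => mxw; apply: xN; split => //; rewrite /C/= /nu /mrestr.
have wE : m `[(0 : R)%R, w]%classic = m `[(0 : R)%R, x]%classic + m `](x : R), w]%classic.
  rewrite -measureU//.
  - by congr (m _); rewrite (@itv_bndbnd_setU _ _ _ (BRight (x : R))) ?bnd_simp//; case/andP: xw.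
  - apply/seteqP; split => // y [] /=; rewrite !in_itv/= => /andP[_ yx] /andP[].
    by rewrite ltNge yx.
have fx : m `[(0 : R)%R, x]%classic \is a fin_num by rewrite fin_num_measure.
have -> : `](x : R), +oo[%classic `&` `[(0 : R)%R, w]%classic = `](x : R), w]%classic.
  apply/seteqP; split => y /=; rewrite !in_itv/= andbT.
    by move=> [-> /andP[]].
  move=> /andP[xy ->]; rewrite xy; split => //; rewrite andbT.
  by apply: le_trans (ltW xy); case/andP: xw.
have -> : m `](x : R), w]%classic = m `[(0 : R)%R, w]%classic - m `[(0 : R)%R, x]%classic.
  by rewrite wE addeAC subee// add0e.
by rewrite -[X in X - _]mxw subee.
Qed.

Variable F : cumulativeBounded (0 : R) (1 : R).
Variables (f lambda r0 : R -> R) (omega0 : R).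
Hypothesis Ff : has_pdf F f.
Hypothesis lambda_ge0 : forall s : R, (0 <= s -> 0 <= lambda s)%R.
Hypothesis lambda_locint : forall t : R, (0 <= t)%R ->
     lebesgue_measure.-integrable `[0%R, t] (EFin \o lambda).
Hypothesis r0_ge0 : forall s : R, (0 <= s -> 0 <= r0 s)%R.
Hypothesis mr0 : measurable_fun (`[0%R, +oo[%classic : set mR) r0.

Local Notation lam := (extended_rate F lambda r0 omega0).
Local Notation ulam := (uncut_rate F lambda r0).

Variables (t : R) (m : fmeas).
Hypothesis t0 : (0 <= t)%R.
Hypothesis mE : density_of m (fun u => tail F u * ulam (t - u))%R.

Lemma potential_queue_atomless x : m [set x] = 0.
Proof.
have mx : measurable ([set x] : set mR) by exact: (measurable_set1 (x : R)).
have [x0|x0] := leP 0%R x.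
  rewrite -[LHS]mul1e -integral_cst// (density_of_integral _ _ _ _ mE)//.
    exact: integral_set1.
  by move=> y ->; rewrite /= in_itv/= andbT.
apply/eqP; rewrite -measure_le0; case: mE => <- _ _ _.
apply: le_measure; rewrite ?inE//.
by move=> y ->; rewrite /= in_itv.
Qed.

Lemma measurable_reversed (g : R -> R) : measurable_fun [set: mR] g ->
  measurable_fun [set: mR] (fun x : mR => g (t - x)%R).
Proof.
by move=> mg; apply: (measurableT_comp mg); exact: measurable_funB.
Qed.

(** On ages in [0, t + omega0] the two rates can differ only at x = t + omega0, since the cut-off at
    time -omega0 is strict; one point is Lebesgue-null. *)
Lemma integral_extended_rate (D : set mR) (h : R -> \bar R) :
  measurable D -> D `<=` `[0%R, (t + omega0)%R]%classic ->
  measurable_fun D h -> (forall x, D x -> 0 <= h x) ->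
  \int[leb]_(x in D) (h x * (lam (t - x))%:E) =
  \int[leb]_(x in D) (h x * (ulam (t - x))%:E).
Proof.
move=> mD DT mh h0.
have mN : measurable ([set (t + omega0)%R] : set mR) by exact: measurable_set1.
have N0 := lebesgue_measure_set1 (t + omega0)%R.
rewrite (ge0_negligible_integral mN mD _ _ N0); first last.
- by move=> x Dx; rewrite mule_ge0 ?h0// lee_fin extended_rate_ge0.
- apply: emeasurable_funM => //; apply/measurable_EFinP/measurable_funTS.
  by apply: measurable_reversed; exact: measurable_extended_rate.
rewrite [RHS](ge0_negligible_integral mN mD _ _ N0); first last.
- by move=> x Dx; rewrite mule_ge0 ?h0// lee_fin uncut_rate_ge0.
- apply: emeasurable_funM => //; apply/measurable_EFinP/measurable_funTS.
  by apply: measurable_reversed; exact: measurable_uncut_rate.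
apply: eq_integral => x /[!inE] -[/DT /=]; rewrite in_itv/= => /andP[_ xle] /eqP xT.
have xlt : (x < t + omega0)%R by rewrite lt_neqAle xT.
by rewrite extended_rateE (_ : (- omega0 < t - x)%R) ?orbT//; lra.
Qed.

Lemma Fd_tE x : (x <= t + omega0)%R -> Fd_t F lam t x = m `[0%R, x]%classic.
Proof.
move=> xT; have [x0|x0] := leP 0%R x; last first.
  have itv0 : `[0%R, x]%classic = set0 :> set R.
    by apply: set_itv_ge; rewrite bnd_simp -ltNge.
  by rewrite /Fd_t itv0 integral_set0 measure0.
case: mE => _ _ _ ->//; rewrite /Fd_t.
under eq_integral do rewrite EFinM; under [RHS]eq_integral do rewrite EFinM.
apply: integral_extended_rate => //.
- by move=> y /=; rewrite !in_itv/= => /andP[-> /le_trans]; exact.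
- by apply/measurable_EFinP/measurable_funTS; exact: measurable_tail.
- by move=> y _; rewrite lee_fin tail_ge0.
Qed.

(** The factor [tail F x] absent on the left is produced by [integral_hazard]; multiplied by the
    rate it is the density of [m]. *)
Lemma integral_pdf_rate (D : set mR) : measurable D ->
  D `<=` `[0%R, (t + omega0)%R]%classic ->
  \int[leb]_(x in D) (f x * lam (t - x))%:E = \int[m]_(x in D) (f x / tail F x)%:E.
Proof.
move=> mD DT; case: (Ff) => mf f0 _.
have mulam : measurable_fun [set: mR] (fun x : mR => ulam (t - x)%R).
  by apply: measurable_reversed; exact: measurable_uncut_rate.
under eq_integral do rewrite EFinM.
rewrite (integral_extended_rate D (EFin \o f))//; last 2 first.
- exact/measurable_EFinP/measurable_funTS.
- by move=> x _; rewrite lee_fin.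
rewrite (integral_hazard _ _ Ff D (fun x => (ulam (t - x))%:E))//; last 2 first.
- exact/measurable_EFinP/measurable_funTS.
- by move=> x _; rewrite lee_fin uncut_rate_ge0.
rewrite (density_of_integral _ _ _ _ mE)//.
- by move=> x /DT/=; rewrite !in_itv/= andbT => /andP[].
- apply/measurable_EFinP/measurable_funTS/measurable_funM => //.
  exact: measurable_tailV.
- by move=> x _; rewrite lee_fin divr_ge0 ?tail_ge0.
Qed.

Variable w : R.
Hypothesis w_bound : (0 <= w <= t + omega0)%R.

Lemma integral_pdf_rate_level (D : set mR) : measurable D -> D `<=` `[0%R, w]%classic ->
  (forall x : R, (0 <= x <= w)%R -> m `[0%R, x]%classic < m `[0%R, w]%classic -> D x) ->
  \int[leb]_(x in D) (f x * lam (t - x))%:E =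
  \int[m]_(x in `[0%R, w]) (f x / tail F x)%:E.
Proof.
move=> mD Dw wD; rewrite integral_pdf_rate//; last first.
  by move=> x /Dw /=; rewrite !in_itv/= => /andP[-> /le_trans]; apply; case/andP: w_bound.
case: (Ff) => mf f0 _.
apply: integral_level_set => //.
- exact: potential_queue_atomless.
- apply/measurable_EFinP/measurable_funTS/measurable_funM => //.
  exact: measurable_tailV.
- by move=> x _; rewrite lee_fin divr_ge0 ?tail_ge0.
Qed.

(** The interval up to the infimum satisfies the sandwich of [integral_pdf_rate_level]: w belongs to
    the set, so the infimum is at most w, and an age x beyond the infimum lies beyond some y with
    m([0, y]) >= m([0, w]). *)
Lemma F_t_Fd_t_inv :
  F_t f lam t (Fd_t_inv F lam omega0 t (m `[0%R, w]%classic)) =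
  \int[m]_(x in `[0%R, w]) (f x / tail F x)%:E.
Proof.
have /andP[w0 wT] := w_bound.
rewrite /F_t /Fd_t_inv; set S := (X in inf X).
have Sw : S w by rewrite /S/= Fd_tE//; split; rewrite ?w0 ?wT.
have S0 : lbound S 0%R by move=> x [/andP[]].
have Sinf : has_inf S by split; [exists w|exists 0%R].
have infw : (inf S <= w)%R by apply: ge_inf => //; exists 0%R.
apply: integral_pdf_rate_level.
- exact: measurable_itv.
- by move=> x /=; rewrite !in_itv/= => /andP[-> /le_trans]; exact.
- move=> x /andP[x0 xw] mxw; rewrite /= in_itv/= x0 leNgt; apply/negP => Sx.
  have [y [/andP[y0 yT] +] yx] := inf_lt Sinf.1 Sx.
  rewrite Fd_tE//; apply/negP; rewrite -ltNge; apply: le_lt_trans mxw.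
  apply: le_measure; rewrite ?inE//; try exact: measurable_itv.
  by move=> u /=; rewrite !in_itv/= => /andP[-> /le_trans]; apply; exact: ltW.
Qed.

Lemma H_tE q : q%:E = m `[0%R, w]%classic ->
  H_t F f lam omega0 t q = (lam t)%:E - \int[m]_(x in `[0%R, w]) (f x / tail F x)%:E.
Proof.
have /andP[w0 wT] := w_bound.
move=> qE; rewrite /H_t; case: ifPn => [_|]; first by rewrite qE F_t_Fd_t_inv.
(* In the saturated case no content lies between w and t + omega0, so the capped argument [N_t] is
   again the mass up to w and both branches agree. *)
rewrite -leNgt /N_t Fd_tE// => Nq; suff -> : m `[0%R, (t + omega0)%R]%classic = m `[0%R, w]%classic.
  by rewrite F_t_Fd_t_inv.
apply/eqP; rewrite eq_le -{1}qE Nq/=.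
apply: le_measure; rewrite ?inE//; try exact: measurable_itv.
by move=> u /=; rewrite !in_itv/= => /andP[-> /le_trans]; apply.
Qed.

End Outflow.

(** * Measurability of the abandonment rate in time *)

Section Abandonment.
Context {R : realType}.
Local Notation mR := (measurableTypeR R).
Local Notation leb := (@lebesgue_measure R).
Local Open Scope ereal_scope.

(* No measurability of h: the integral is a supremum over simple functions below h.
   It gives the monotonicity of L before its integrand is known to be measurable. *)
Lemma ge0_subset_integral_nonmeasurable d (T : measurableType d)
  (mu : {measure set T -> \bar R}) (A B : set T) (h : T -> \bar R) :
  A `<=` B -> (forall x, B x -> 0 <= h x) ->
  \int[mu]_(x in A) h x <= \int[mu]_(x in B) h x.
Proof.
move=> AB h0; rewrite (integral_mkcond A) (integral_mkcond B).
have hA x : (h \_ A) x <= (h \_ B) x.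
  rewrite !patchE; case: ifPn => [/[!inE]/AB xB|_]; first by rewrite mem_set.
  by case: ifPn => // /[!inE]; exact: h0.
have hA0 x : 0 <= (h \_ A) x by apply: erestrict_ge0 => y /AB; exact: h0.
rewrite !ge0_integralTE//; last by move=> x; exact: le_trans (hA0 x) (hA x).
apply: le_ereal_sup => _ [g gA <-]; exists g => // x.
exact: le_trans (gA x) (hA x).
Qed.

Variables (f : R -> R) (v lam : R -> R) (q : R -> R).
Hypotheses (mf : measurable_fun [set: mR] f) (f_ge0 : forall x, (0 <= f x)%R).
Hypotheses (mv : measurable_fun [set: mR] v) (v_ge0 : forall x, (0 <= v x)%R).
Hypotheses (mlam : measurable_fun [set: mR] lam) (lam_ge0 : forall x, (0 <= lam x)%R).
Hypothesis mq : measurable_fun [set: mR] q.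

Let ms1 : measurable_fun [set: mR * mR] (fun p : mR * mR => lam ((p.1 : R) - (p.2 : R)))%R.
Proof.
apply: (measurableT_comp mlam); apply: measurable_funB.
- exact: measurable_fst.
- exact: measurable_snd.
Qed.

(** The variable upper bound becomes the indicator of a measurable set in three variables, so that
    Tonelli gives joint measurability in time and age. *)
Lemma measurable_partial_content : measurable_fun [set: mR * mR]
  (fun p : mR * mR => \int[leb]_(u in `[(0 : R)%R, (p.2 : R)]) (v u * lam ((p.1 : R) - u))%:E).
Proof.
pose S : set ((mR * mR) * mR) := [set p | (0 <= (p.2 : R) <= (p.1.2 : R))%R].
have mS : measurable S.
  have -> : S = (fun p : (mR * mR) * mR => (0 : R) <= (p.2 : R))%R @^-1` [set true] `&`
      (fun p : (mR * mR) * mR => (p.2 : R) <= (p.1.2 : R))%R @^-1` [set true].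
    by apply/seteqP; split => p /=; [move=> /andP[]|move=> [? ?]; apply/andP].
  have m2 : measurable_fun [set: (mR * mR) * mR] (fun p => p.2 : R) by exact: measurable_snd.
  have m12 : measurable_fun [set: (mR * mR) * mR] (fun p => p.1.2 : R).
    by apply: measurableT_comp => //; exact: measurable_snd.
  by apply: measurableI; rewrite -[X in measurable X]setTI; apply: measurable_fun_ler.
pose g (p : (mR * mR) * mR) : \bar R := (v p.2 * lam ((p.1.1 : R) - p.2))%:E * (\1_S p)%:E.
have mg : measurable_fun [set: (mR * mR) * mR] g.
  apply: emeasurable_funM; last by apply/measurable_EFinP; exact: measurable_indic.
  apply/measurable_EFinP; apply: measurable_funM; first exact: measurableT_comp.
  apply: (measurableT_comp mlam); apply: measurable_funB; last exact: measurable_snd.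
  by apply: measurableT_comp => //; exact: measurable_fst.
have g0 p : 0 <= g p by rewrite mule_ge0// lee_fin mulr_ge0.
have := @measurable_fun_fubini_tonelli_F _ _ _ _ _ leb g mg g0.
apply: eq_measurable_fun => -[s x] _; rewrite /fubini_F /g/= [RHS]integral_mkcond epatch_indic.
apply: eq_integral => u _ /=; congr (_ * _%:E); rewrite !indicE.
Qed.

(* The level set of the queue content stands for the ages below omega s; omega itself
   is not known to be measurable. *)
Definition abandonment_rate (s : R) : \bar R :=
  \int[leb]_(x in [set x : mR | (0 <= (x : R))%R /\
      \int[leb]_(u in `[(0 : R)%R, (x : R)]) (v u * lam (s - u))%:E < (q s)%:E])
    (f x * lam (s - x))%:E.

Lemma abandonment_rate_ge0 s : 0 <= abandonment_rate s.
Proof. by apply: integral_ge0 => x _; rewrite lee_fin mulr_ge0. Qed.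

Lemma measurable_below s : measurable [set x : mR | (0 <= (x : R))%R /\
      \int[leb]_(u in `[(0 : R)%R, (x : R)]) (v u * lam (s - u))%:E < (q s)%:E].
Proof.
have -> : [set x : mR | (0 <= (x : R))%R /\
      \int[leb]_(u in `[(0 : R)%R, (x : R)]) (v u * lam (s - u))%:E < (q s)%:E] =
   (`[(0 : R)%R, +oo[%classic : set mR) `&` [set x : mR |
      \int[leb]_(u in `[(0 : R)%R, (x : R)]) (v u * lam (s - u))%:E < (q s)%:E].
  by apply/seteqP; split => x /=; rewrite in_itv/= andbT.
apply: measurable_lte; first exact: measurable_itv.
- exact: measurable_funTS (measurable_fun_pair2 (s : mR) measurable_partial_content).
- exact: measurable_cst.
Qed.

(** Joint measurability of the content, together with that of [q], makes the level sets the sections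
    of one measurable set of the plane. *)
Lemma measurable_abandonment_rate : measurable_fun [set: mR] abandonment_rate.
Proof.
pose S : set (mR * mR) := [set p | (0 <= (p.2 : R))%R /\
   \int[leb]_(u in `[(0 : R)%R, (p.2 : R)]) (v u * lam ((p.1 : R) - u))%:E < (q p.1)%:E].
have mS : measurable S.
  have -> : S = (fun p : mR * mR => (0 : R) <= (p.2 : R))%R @^-1` [set true] `&`
     (setT `&` [set p | \int[leb]_(u in `[(0 : R)%R, (p.2 : R)]) (v u * lam ((p.1 : R) - u))%:E < (q p.1)%:E]).
    by apply/seteqP; split => p /= [p0]; [|move=> [_]].
  apply: measurableI.
    by rewrite -[X in measurable X]setTI; apply: measurable_fun_ler.
  apply: measurable_lte => //; first exact: measurable_partial_content.
  by apply/measurable_EFinP; apply: measurableT_comp.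
pose g (p : mR * mR) : \bar R := (f p.2 * lam ((p.1 : R) - p.2))%:E * (\1_S p)%:E.
have mg : measurable_fun [set: mR * mR] g.
  apply: emeasurable_funM; last by apply/measurable_EFinP; exact: measurable_indic.
  by apply/measurable_EFinP; apply: measurable_funM => //; exact: measurableT_comp.
have g0 p : 0 <= g p by rewrite mule_ge0// lee_fin mulr_ge0.
have := @measurable_fun_fubini_tonelli_F _ _ _ _ _ leb g mg g0.
apply: eq_measurable_fun => s _; rewrite /fubini_F /g/= /abandonment_rate [RHS]integral_mkcond epatch_indic.
apply: eq_integral => u _ /=; congr (_ * _%:E); rewrite !indicE.
Qed.

End Abandonment.

(** * Convolution with G, with its tail and with G_e *)

Section Convolution.
Context {R : realType}.
Local Notation mR := (measurableTypeR R).
Local Notation leb := (@lebesgue_measure R).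
Local Open Scope ereal_scope.
Variables (G : cumulativeBounded (0 : R) (1 : R)).
Hypothesis G0 : nonneg_supported G.

(** [G] and [tail G] add up to 1; the additive form avoids subtracting integrals that might be
    infinite. *)
Lemma integral_tail_conv (nu : {measure set mR -> \bar R}) (k : R -> \bar R) (t : R) :
  measurable_fun [set: mR] k -> (forall s, 0 <= k s) ->
  \int[nu]_(s in `[0%R, t]) (k s * (tail G (t - s))%:E) +
  \int[nu]_(s in `[0%R, t]) (k s * (G (t - s)%R)%:E) = \int[nu]_(s in `[0%R, t]) k s.
Proof.
move=> mk k0.
have mc : measurable_fun [set: mR] (fun s : mR => t - (s : R))%R.
  by apply: measurable_funB => //; exact: measurable_cst.
rewrite -ge0_integralD//.
- apply: eq_integral => s _; rewrite -ge0_muleDr ?lee_fin ?tail_ge0//; last first.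
    by have /andP[] := cumulative_bounds G (t - s)%R.
  by rewrite -EFinD /tail subrK mule1.
- by move=> s _; rewrite mule_ge0// lee_fin tail_ge0.
- apply: measurable_funTS; apply: emeasurable_funM => //; apply/measurable_EFinP.
  exact: measurableT_comp (measurable_tail G) mc.
- by move=> s _; rewrite mule_ge0// lee_fin; have /andP[] := cumulative_bounds G (t - s)%R.
- apply: measurable_funTS; apply: emeasurable_funM => //; apply/measurable_EFinP.
  exact: measurableT_comp (measurable_cdf G) mc.
Qed.

(** dG_e has density mu * [tail G] on the half-line: the prefactor cancels mu, and reflecting s to t
    - s moves the shift from [k] to the tail. *)
Lemma integral_equilibrium (mu : {posnum R}) (k : R -> \bar R) (t : R) :
  measurable_fun [set: mR] k -> (forall s, 0 <= k s) ->
  (mu%:num^-1)%:E * \int[lebesgue_stieltjes_measure (equilibrium mu G)]_(s in `[0%R, t]) k (t - s)%R =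
  \int[leb]_(s in `[0%R, t]) (k s * (tail G (t - s))%:E).
Proof.
move=> mk k0.
have mI (i : interval R) : measurable ([set` i] : set mR) by exact: measurable_itv.
have mc : measurable_fun [set: mR] (fun s : mR => t - (s : R))%R.
  by apply: measurable_funB => //; exact: measurable_cst.
have mkt : measurable_fun [set: mR] (fun s : mR => k (t - (s : R))%R).
  exact: (measurableT_comp mk mc).
have mmt : measurable_fun [set: mR] (fun s => mu%:num * tail G s)%R.
  by apply: measurable_funM => //; exact: measurable_tail.
have eq0 y : (y < 0)%R -> equilibrium mu G y = 0%R.
  move=> y0; rewrite /equilibrium set_itv_ge ?Rintegral_set0 ?mulr0//.
  by rewrite bnd_simp -ltNge.
have eqE y : (0 <= y)%R -> (equilibrium mu G y)%:E =
    \int[leb]_(s in `[0%R, y]) (mu%:num * tail G s)%:E.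
  move=> y0; rewrite /equilibrium EFinM /Rintegral fineK; last first.
    rewrite ge0_fin_numE; last by apply: integral_ge0 => s _; rewrite lee_fin tail_ge0.
    apply: (@le_lt_trans _ _ (\int[leb]_(s in `[0%R, y]) (cst 1 s))).
      apply: ge0_le_integral => //.
      - by move=> s _; rewrite lee_fin tail_ge0.
      - by apply/measurable_EFinP/measurable_funTS; exact: measurable_tail.
      - by move=> s _; rewrite lee_fin gerBl; have /andP[] := cumulative_bounds G s.
    by rewrite integral_cst//= mul1e lebesgue_measure_itv/=; case: ifP; rewrite ltry.
  under [RHS]eq_integral do rewrite EFinM.
  rewrite ge0_integralZl//.
  - by apply/measurable_EFinP/measurable_funTS; exact: measurable_tail.
  - by move=> s _; rewrite lee_fin tail_ge0.
rewrite (@integral_half_line_density _ _ (fun s => mu%:num * tail G s)%R)//; first last.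
- exact: measurable_funTS.
- by move=> s /=; rewrite !in_itv/= andbT => /andP[].
- by move=> y y0; rewrite [X in X < _]lebesgue_stieltjes_itv0// ltry.
- by move=> y y0; rewrite [LHS]lebesgue_stieltjes_itv0// eqE.
- exact: measurable_funTS.
- by move=> y _; rewrite mulr_ge0// tail_ge0.
- exact: lebesgue_stieltjes_neg.
have mkG : measurable_fun [set: mR] (fun s : mR => k (t - (s : R))%R * (tail G s)%:E).
  apply: emeasurable_funM => //; apply/measurable_EFinP; exact: measurable_tail.
have -> : \int[leb]_(s in `[0%R, t]) (k (t - s)%R * (mu%:num * tail G s)%:E) =
    mu%:num%:E * \int[leb]_(s in `[0%R, t]) (k (t - s)%R * (tail G s)%:E).
  rewrite -ge0_integralZl//.
  - by apply: eq_integral => s _; rewrite EFinM muleCA.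
  - exact: measurable_funTS.
  - by move=> s _; rewrite mule_ge0// lee_fin tail_ge0.
rewrite muleA -EFinM mulVf// mul1e.
rewrite -(@lebesgue_reflect _ t (`[0%R, t]%classic : set R) (`[0%R, t]%classic : set R)
  (fun s => k s * (tail G (t - s))%:E))//.
- by apply: eq_integral => s _; rewrite subKr.
- by move=> y /=; rewrite !in_itv/=; split; lra.
- apply: measurable_funTS; apply: emeasurable_funM => //; apply/measurable_EFinP.
  exact: measurableT_comp (measurable_tail G) mc.
- by move=> s _; rewrite mule_ge0// lee_fin tail_ge0.
Qed.

End Convolution.

(** * The content in service and the key equation *)

Section FluidModel.
Context {R : realType}.
Local Notation mR := (measurableTypeR R).
Local Notation leb := (@lebesgue_measure R).
Local Notation fmeas := {finite_measure set mR -> \bar R}.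
Local Open Scope ereal_scope.

(** The model prescribes masses of bounded age intervals only, so the total is a limit over growing
    ages. *)
Lemma service_content (G : cumulativeBounded (0 : R) (1 : R)) (m : fmeas)
  (z0 : R -> R) (A : cumulative R R) (t : R) :
  (0 <= t)%R -> (forall x, (0 <= x)%R -> (0 <= z0 x)%R) ->
  measurable_fun (`[0%R, +oo[%classic : set mR) z0 ->
  (forall x, (0 <= x)%R -> m `[0%R, x]%classic = aged_content G z0 A t x) ->
  m `[0%R, +oo[%classic = initial_residual_service G z0 t +
    \int[lebesgue_stieltjes_measure A]_(s in `[0%R, t]) (tail G (t - s))%:E.
Proof.
move=> t0 z0_ge0 mz0 mE.
pose J := \int[lebesgue_stieltjes_measure A]_(s in `[0%R, t]) (tail G (t - s))%:E.
have J0 : 0 <= J by apply: integral_ge0 => s _; rewrite lee_fin tail_ge0.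
pose h (s : R) : R := (tail G (s + t) / tail G s * (z0 \_ `[0%R, +oo[%classic) s)%R.
have hE s : (0 <= s)%R -> h s = (tail G (s + t) / tail G s * z0 s)%R.
  by move=> s0; rewrite /h patchE mem_set//= in_itv/= s0.
have h0 s : (0 <= h s)%R.
  rewrite /h mulr_ge0 ?divr_ge0 ?tail_ge0// patchE.
  by case: ifPn => //; rewrite inE/= in_itv/= andbT => /z0_ge0.
have mh : measurable_fun [set: mR] h.
  have mst : measurable_fun [set: mR] (fun s : mR => (s : R) + t)%R.
    by apply: measurable_funD => //; exact: measurable_cst.
  apply: measurable_funM; last exact: measurable_half_line.
  apply: measurable_funM; last exact: measurable_tailV.
  exact: measurableT_comp (measurable_tail G) mst.
have IE : initial_residual_service G z0 t = \int[leb]_(s in `[0%R, +oo[) (h s)%:E.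
  by apply: eq_integral => s /[!inE]/=; rewrite in_itv/= andbT => s0; rewrite hE.
rewrite IE.
(* With age bound t + n, initial ages run exactly over [0, n], and the inflow integral is already
   the full one over [0, t]. *)
have mn n : m `[0%R, (t + n%:R)%R]%classic = \int[leb]_(s in `[0%R, n%:R]) (h s)%:E + J.
  rewrite mE ?addr_ge0// /aged_content.
  rewrite (_ : t + n%:R - t = n%:R)%R; last by ring.
  rewrite (_ : t - (t + n%:R) = - n%:R)%R; last by ring.
  rewrite (max_l (ler0n _ _)) max_r ?oppr_le0//.
  congr (_ + _); apply: eq_integral => s /[!inE]/=; rewrite in_itv/= => /andP[s0 _].
  by rewrite hE.
have c1 : m `[0%R, (t + n%:R)%R]%classic @[n --> \oo] --> m `[0%R, +oo[%classic.
  have -> : `[0%R, +oo[%classic = \bigcup_n `[(0 : R)%R, (t + n%:R)%R]%classic.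
    apply/seteqP; split => x /=; rewrite in_itv/= ?andbT.
      move=> x0; exists (Num.bound x) => //=; rewrite in_itv/= x0/=.
      by rewrite (le_trans (ltW (ltr_bound x)))// lerDr.
    by move=> [n _] /=; rewrite in_itv/= => /andP[].
  apply: (@nondecreasing_cvg_mu _ _ _ m (fun n => `[(0 : R)%R, (t + n%:R)%R]%classic)).
  - by move=> n; exact: measurable_itv.
  - by apply: bigcupT_measurable => n; exact: measurable_itv.
  - move=> i j ij; apply/subsetPset => x /=; rewrite !in_itv/= => /andP[->] /le_trans; apply.
    by rewrite lerD2l ler_nat.
have c2 := @ge0_cvgn_integral _ leb h h0 mh.
apply: (cvg_unique _ c1) => //.
rewrite (_ : (fun n => _) = (fun n => \int[leb]_(s in `[0%R, n%:R]) (h s)%:E + J)); last first.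
  by apply/funext => n; exact: mn.
apply: cvgeD; [|exact: c2|exact: cvg_cst].
apply: ge0_adde_def; rewrite inE; last exact: J0.
by apply: integral_ge0 => s _; rewrite lee_fin.
Qed.

End FluidModel.

(** [jE], [jL], [jA] stand for the convolutions with the tail of G, and [e], [l], [a] for those with
    G. The hypotheses have real totals, which rules out infinite values, so the cancellation takes
    place in the reals. *)
Lemma ereal_balance {R : realType} {jA a jE e jL l q i : \bar R}
  {At Et Lt Q0 Gt Qt Zt : R} :
  (jE + e = Et%:E)%E -> (jL + l = Lt%:E)%E -> (jA + a = At%:E)%E ->
  (q + a + l = (Q0 * Gt)%:E + e)%E -> (Zt%:E = i + jA)%E ->
  Qt = Q0 + Et - Lt - At ->
  ((Qt + Zt)%:E = i + (Q0 * (1 - Gt))%:E + (jE - jL) + q)%E.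
Proof.
case: jE => [jE||]; case: e => [e||] //= [Ee].
case: jL => [jL||]; case: l => [l||] //= [Le].
case: jA => [jA||]; case: a => [a||] //= [Ae].
case: q => [q||] //= [qe]; case: i => [i||] //= [ie] Qe.
by rewrite -!EFinD; congr (_%:E); lra.
Qed.

Theorem proposition4p1 (R : realType)
  (F G : cumulativeBounded (0 : R) (1 : R)) (f : R -> R) (mu : {posnum R})
  (lambda : R -> R) (E : cumulative R R)
  (Ra Za : R -> {finite_measure set (measurableTypeR R) -> \bar R})
  (r z : R -> R -> R) (omega : R -> R) (A : cumulative R R) (L : R -> R)
  (F_nonneg : nonneg_supported F) (G_nonneg : nonneg_supported G)
  (F_lipschitz : [lipschitz (F : R -> R) x | x in [set: R]])
  (F_pdf : has_pdf F f)
  (G_continuous : continuous (G : R -> R))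
  (G_mean : has_mean G (mu%:num)^-1)
  (lambda_ge0 : forall s : R, 0 <= s -> 0 <= lambda s)
  (lambda_locint : forall t : R, 0 <= t ->
     lebesgue_measure.-integrable `[0%R, t] (EFin \o lambda))
  (E_lambda : forall t : R,
     (E t)%:E = (\int[lebesgue_measure]_(s in `[0%R, t]) (lambda s)%:E)%E)
  (model : elapsed_fluid_model F G f E Ra Za r z omega A L) :
  let lam := extended_rate F lambda (r 0) (omega 0) in
  let X := Xbar Ra Za omega in
  let Q := Qbar Ra omega in
  let H := H_t F f lam (omega 0) in
  forall t : R, 0 <= t ->
    ((X t)%:E =
       initial_residual_service G (z 0%R) t
       + (Q 0 * tail G t)%:E
       + ((mu%:num)^-1)%:E
         * \int[lebesgue_stieltjes_measure (equilibrium mu G)]_(s in `[0%R, t])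
             H (t - s)%R (Num.max (X (t - s) - 1) 0)%R
       + \int[lebesgue_stieltjes_measure G]_(s in `[0%R, t])
             (Num.max (X (t - s) - 1) 0)%:E)%E.
Proof.
move=> lam X Q H t t0.
case: model => dRa dZa om E0 A0 RaE ZaE LE bal QE ZE.
have [_ mr0 r0_ge0 _] := dRa 0 (lexx 0).
have [_ mz0 z0_ge0 _] := dZa 0 (lexx 0).
have mI (i : interval R) : measurable ([set` i] : set (measurableTypeR R)).
  exact: measurable_itv.
have [mf f_ge0 _] := F_pdf.
have lam_ge0 s : 0 <= lam s by exact: extended_rate_ge0.
have mlam : measurable_fun [set: measurableTypeR R] lam.
  exact: measurable_extended_rate.
have dR s : 0 <= s ->
    density_of (Ra s) (fun u => tail F u * uncut_rate F lambda (r 0) (s - u)).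
  move=> s0; have [Ra0 _ _ _] := dRa s s0; split => //.
  - apply/measurable_funTS/measurable_funM; first exact: measurable_tail.
    by apply: measurable_reversed; exact: measurable_uncut_rate.
  - by move=> u _; rewrite mulr_ge0 ?tail_ge0 ?uncut_rate_ge0.
  - by move=> x x0; rewrite RaE//; exact: aged_contentE.
have QfinE s : 0 <= s -> (Q s)%:E = Ra s `[0%R, omega s]%classic.
  by move=> s0; rewrite /Q /Qbar fineK//; exact: (fin_num_measure _ _ (mI _)).
pose hazard_outflow s := (\int[lebesgue_measure]_(x in `[0%R, omega s])
  (f x / (1 - F x) * r s x)%:E)%E.
(* Integration against [Ra s] refers to no particular density; this is how the given [r s] is
   exchanged for the explicit one of [dR]. *)
have hazard_outflowE s : 0 <= s ->
    hazard_outflow s = (\int[Ra s]_(x in `[0%R, omega s]) (f x / tail F x)%:E)%E.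
  move=> s0; rewrite (density_of_integral _ _ _ _ (dRa s s0))//.
  - by move=> x /=; rewrite !in_itv/= andbT => /andP[].
  - apply/measurable_EFinP/measurable_funTS/measurable_funM => //.
    exact: measurable_tailV.
  - by move=> x _; rewrite lee_fin divr_ge0 ?tail_ge0.
have hazard_outflow_ge0 s : 0 <= s -> (0 <= hazard_outflow s)%E.
  move=> s0; rewrite hazard_outflowE//; apply: integral_ge0 => x _.
  by rewrite lee_fin divr_ge0 ?tail_ge0.
have L_ge0 s : 0 <= s -> 0 <= L s.
  move=> s0; rewrite -lee_fin LE//; apply: integral_ge0 => u /=.
  by rewrite in_itv/= => /andP[u0 _]; exact: hazard_outflow_ge0.
(* The model constrains [L] at nonnegative times only; with value 0 before, it is monotone on the
   whole line, hence measurable. *)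
pose L' s := if 0 <= s then L s else 0.
have L'_nd : {homo L' : x y / x <= y}.
  move=> x y xy; rewrite /L'; case: ifPn => [x0|_]; last by case: ifPn => // /L_ge0.
  have y0 := le_trans x0 xy; rewrite y0 -lee_fin !LE//.
  apply: ge0_subset_integral_nonmeasurable.
    by move=> u /=; rewrite !in_itv/= => /andP[-> /le_trans]; exact.
  by move=> u /=; rewrite in_itv/= => /andP[u0 _]; exact: hazard_outflow_ge0.
(* A combination of monotone functions, so measurable, that agrees with [Q] at nonnegative times by
   the balance equation. *)
pose q s := Q 0 + E s - L' s - A s.
have qE s : 0 <= s -> q s = Q s by move=> s0; rewrite /q /L' s0 [RHS]bal.
have mmono (g : R -> R) : {homo g : x y / x <= y} ->
    measurable_fun [set: measurableTypeR R] g.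
  by move=> ?; exact: nondecreasing_measurable.
have mq : measurable_fun [set: measurableTypeR R] q.
  apply: measurable_funB; last by apply: mmono => x y; exact: cumulative_is_nondecreasing.
  apply: measurable_funB; last exact: mmono.
  by apply: measurable_funD => //; apply: mmono => x y; exact: cumulative_is_nondecreasing.
pose phi := abandonment_rate f (tail F) lam q.
have phi_ge0 s : (0 <= phi s)%E by exact: abandonment_rate_ge0.
have mphi : measurable_fun [set: measurableTypeR R] phi.
  by apply: measurable_abandonment_rate => //; [exact: measurable_tail|exact: tail_ge0].
have FdE s x : 0 <= s -> x <= s + omega 0 ->
    (\int[lebesgue_measure]_(u in `[0%R, x]) (tail F u * lam (s - u))%:E)%E =
    Ra s `[0%R, x]%classic.
  by move=> s0 xs; apply: Fd_tE => //; exact: dR.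
have phiE s : 0 <= s -> phi s = hazard_outflow s.
  move=> s0; rewrite hazard_outflowE//.
  apply: (@integral_pdf_rate_level _ _ _ _ _ (omega 0)) => //.
  - exact: dR.
  - exact: om.
  - by apply: measurable_below => //; [exact: measurable_tail|exact: tail_ge0].
  - move=> x [/= x0 xq]; rewrite in_itv/= x0 leNgt; apply/negP => wx.
    move: xq; apply/negP; rewrite -leNgt qE// QfinE// -FdE//; last by case/andP: (om s s0).
    (* Here x may exceed s + omega 0, where the integral of the cut-off rate need no longer be the
       mass under [Ra s]; its monotonicity in x suffices. *)
    apply: ge0_subset_integral_nonmeasurable.
      by move=> u /=; rewrite !in_itv/= => /andP[-> /le_trans]; apply; exact: ltW.
    by move=> u _; rewrite lee_fin mulr_ge0 ?tail_ge0.
  - move=> x /andP[x0 xw] xq; split => //; rewrite FdE//; last first.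
      by rewrite (le_trans xw)//; case/andP: (om s s0).
    by rewrite qE// QfinE.
have HE s : 0 <= s -> H s (Num.max (X s - 1) 0) = ((lam s)%:E - phi s)%E.
  move=> s0; rewrite -QE// phiE// hazard_outflowE// /H.
  apply: (@H_tE _ _ _ _ _ _ F_pdf lambda_ge0 lambda_locint r0_ge0 mr0 s) => //.
  - exact: dR.
  - exact: om.
  - exact: QfinE.
pose dG := lebesgue_stieltjes_measure G.
pose dA := lebesgue_stieltjes_measure A.
pose itv_t : set (measurableTypeR R) := `[0%R, t]%classic.
have rev_ge0 u : itv_t u -> 0 <= t - u.
  by rewrite /itv_t/= in_itv/= subr_ge0 => /andP[].
have mrev (g : R -> R) : measurable_fun [set: measurableTypeR R] g ->
    measurable_fun itv_t (fun u => (g (t - u))%:E).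
  by move=> mg; apply/measurable_EFinP/measurable_funTS; exact: measurable_reversed.
have lam_int s : 0 <= s -> (\int[lebesgue_measure]_(u in `[0%R, s]) (lam u)%:E)%E = (E s)%:E.
  move=> s0; rewrite E_lambda; apply: eq_integral => u /[!inE]/=.
  by rewrite in_itv/= /lam /extended_rate => /andP[-> _].
have phi_int s : 0 <= s -> (\int[lebesgue_measure]_(u in `[0%R, s]) phi u)%E = (L s)%:E.
  move=> s0; rewrite (LE s s0); apply: eq_integral => u /[!inE]/=.
  by rewrite in_itv/= => /andP[u0 _]; rewrite phiE.
have E_ge0 s : 0 <= s -> 0 <= E s.
  move=> s0; rewrite -lee_fin -lam_int//; apply: integral_ge0 => u _.
  by rewrite lee_fin.
have A_ge0 s : 0 <= A s.
  have [s0|s0] := leP 0 s; last by rewrite A0.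
  by rewrite -lee_fin -(lebesgue_stieltjes_itv0 A s A0 s0).
have Q_ge0 s : 0 <= Q s by exact: fine_ge0.
have mlamE : measurable_fun [set: measurableTypeR R] (EFin \o lam) by exact/measurable_EFinP.
have lamE_ge0 s : (0 <= (EFin \o lam) s)%E by rewrite lee_fin.
have convA : (\int[dG]_(u in itv_t) (A (t - u))%:E =
    \int[dA]_(s in itv_t) (cst 1 s * (G (t - s))%:E))%E.
  rewrite -(convolution_tonelli dA G (cst 1%E) t G_nonneg (fun=> lee01) (measurable_cst _) t0);
  apply: eq_integral => u /[!inE] /rev_ge0 ut.
  by rewrite (integral_cst dA (mI _)) mul1e; apply/esym; exact: lebesgue_stieltjes_itv0.
have convE : (\int[dG]_(u in itv_t) (E (t - u))%:E =
    \int[lebesgue_measure]_(s in itv_t) ((lam s)%:E * (G (t - s))%:E))%E.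
  rewrite -(convolution_tonelli lebesgue_measure G _ t G_nonneg lamE_ge0 mlamE t0).
  by apply: eq_integral => u /[!inE] /rev_ge0 ut; exact/esym/lam_int.
have convL : (\int[dG]_(u in itv_t) (L' (t - u))%:E =
    \int[lebesgue_measure]_(s in itv_t) (phi s * (G (t - s))%:E))%E.
  rewrite -(convolution_tonelli lebesgue_measure G _ t G_nonneg phi_ge0 mphi t0).
  by apply: eq_integral => u /[!inE] /rev_ge0 ut; rewrite /L' ut; exact/esym/phi_int.
have mE : measurable_fun [set: measurableTypeR R] E.
  by apply: mmono => x y; exact: cumulative_is_nondecreasing.
have mA : measurable_fun [set: measurableTypeR R] A.
  by apply: mmono => x y; exact: cumulative_is_nondecreasing.
have mL' : measurable_fun [set: measurableTypeR R] L' by exact: mmono.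
(* The outgoing terms stand beside [q], so that every integrand is nonnegative; the constant Q(0)
   contributes Q(0) G(t) because dG gives [0, t] mass G(t). *)
have balance_conv : (\int[dG]_(u in itv_t) (q (t - u))%:E + \int[dG]_(u in itv_t) (A (t - u))%:E
     + \int[dG]_(u in itv_t) (L' (t - u))%:E =
     (Q 0 * G t)%:E + \int[dG]_(u in itv_t) (E (t - u))%:E)%E.
  have -> : ((Q 0 * G t)%:E = \int[dG]_(u in itv_t) (cst (Q 0)%:E u))%E.
    rewrite (integral_cst dG (mI _)) [X in (_ * X)%E](lebesgue_stieltjes_itv0 G t G_nonneg t0).
    exact: EFinM.
  have mitv : measurable itv_t by exact: mI.
  have ge0q u : itv_t u -> (0 <= (q (t - u))%:E)%E by move=> /rev_ge0 ut; rewrite lee_fin qE.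
  have ge0A u : itv_t u -> (0 <= (A (t - u))%:E)%E by move=> _; rewrite lee_fin.
  have ge0L u : itv_t u -> (0 <= (L' (t - u))%:E)%E.
    by move=> /rev_ge0 ut; rewrite lee_fin /L' ut L_ge0.
  have ge0E u : itv_t u -> (0 <= (E (t - u))%:E)%E by move=> /rev_ge0 ut; rewrite lee_fin E_ge0.
  have ge0qA u : itv_t u -> (0 <= (q (t - u))%:E + (A (t - u))%:E)%E.
    by move=> ut; rewrite adde_ge0 ?ge0q ?ge0A.
  have ge0c u : itv_t u -> (0 <= cst (Q 0)%:E u)%E by move=> _; rewrite lee_fin.
  have mqA := emeasurable_funD (mrev _ mq) (mrev _ mA).
  rewrite -(ge0_integralD dG mitv ge0q (mrev _ mq) ge0A (mrev _ mA)).
  rewrite -(ge0_integralD dG mitv ge0qA mqA ge0L (mrev _ mL')).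
  rewrite -(ge0_integralD dG mitv ge0c (measurable_cst _) ge0E (mrev _ mE)).
  by apply: eq_integral => u _; rewrite -!EFinD /q; congr (_%:E); ring.
have tailA := integral_tail_conv G dA (cst 1%E) t (measurable_cst _) (fun=> lee01).
have tailE := integral_tail_conv G lebesgue_measure (EFin \o lam) t mlamE lamE_ge0.
have tailL := integral_tail_conv G lebesgue_measure phi t mphi phi_ge0.
pose dGe := lebesgue_stieltjes_measure (equilibrium mu G).
have tailA_fin : (\int[dA]_(s in itv_t) cst 1 s = (A t)%:E)%E.
  by rewrite (integral_cst dA (mI _)) mul1e; exact: lebesgue_stieltjes_itv0.
have service : ((Zbar Za t)%:E = initial_residual_service G (z 0%R) t +
    \int[dA]_(s in itv_t) (cst 1 s * (tail G (t - s))%:E))%E.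
  rewrite /Zbar fineK; last exact: (fin_num_measure _ _ (mI _)).
  rewrite (service_content G (Za t) (z 0) A t t0 z0_ge0 mz0 (fun x => ZaE t x t0)).
  by congr (_ + _)%E; apply: eq_integral => s _; rewrite mul1e.
have equil (k : R -> \bar R) (jk : \bar R) : measurable_fun [set: measurableTypeR R] k ->
    (forall s, 0 <= k s)%E ->
    jk = (\int[lebesgue_measure]_(s in itv_t) (k s * (tail G (t - s))%:E))%E ->
    jk \is a fin_num -> dGe.-integrable itv_t (fun s => k (t - s)%R) /\
    ((mu%:num^-1)%:E * \int[dGe]_(s in itv_t) k (t - s)%R = jk)%E.
  move=> mk k0 jkE jkfin; have eqk := integral_equilibrium G mu k t mk k0.
  rewrite -[RHS]jkE in eqk; split; last exact: eqk.
  apply/integrableP; split.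
    apply: measurable_funTS; apply: (measurableT_comp mk).
    by apply: measurable_funB => //; exact: measurable_cst.
  have -> : (\int[dGe]_(s in itv_t) `|k (t - s)%R| = \int[dGe]_(s in itv_t) k (t - s)%R)%E.
    by apply: eq_integral => s _; rewrite gee0_abs.
  (* The factor mu / mu is inserted because finiteness is known for the integral multiplied by 1 /
     mu. *)
  rewrite -[X in (X < _)%E]mul1e -(mulfV (lt0r_neq0 (gt0 mu))) EFinM -muleA [X in (_ * X)%E]eqk.
  by rewrite ltey_eq fin_numM.
move: tailE tailL tailA balance_conv.
rewrite tailA_fin (phi_int t t0) (lam_int t t0) convA convE convL.
have -> : (\int[dG]_(u in itv_t) (q (t - u))%:E =
    \int[lebesgue_stieltjes_measure G]_(s in `[0%R, t]) (Num.max (X (t - s) - 1) 0)%:E)%E.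
  by apply: eq_integral => u /[!inE] /rev_ge0 ut; rewrite (qE _ ut) [Q _]QE.
move=> tailE tailL tailA balance_conv.
(* The two parts add up to the real number E(t), so each is finite; the same argument with L(t)
   makes [phi] integrable. *)
have /andP[jE_fin _] : (\int[lebesgue_measure]_(s in itv_t) ((EFin \o lam) s * (tail G (t - s))%:E) \is a fin_num)%E
    && (\int[lebesgue_measure]_(s in itv_t) ((EFin \o lam) s * (G (t - s))%:E) \is a fin_num)%E.
  by rewrite -fin_numD tailE.
have /andP[jL_fin _] : (\int[lebesgue_measure]_(s in itv_t) (phi s * (tail G (t - s))%:E) \is a fin_num)%E
    && (\int[lebesgue_measure]_(s in itv_t) (phi s * (G (t - s))%:E) \is a fin_num)%E.
  by rewrite -fin_numD tailL.
have [lam_int_dGe lam_dGe] := equil _ _ mlamE lamE_ge0 erefl jE_fin.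
have [phi_int_dGe phi_dGe] := equil _ _ mphi phi_ge0 erefl jL_fin.
(* Only here is the integrand of the key equation split as [lam] minus [phi]; integrability of both
   under dG_e justifies separating the integrals. *)
have -> : (\int[lebesgue_stieltjes_measure (equilibrium mu G)]_(s in `[0%R, t])
    H (t - s)%R (Num.max (X (t - s) - 1) 0)%R =
    \int[dGe]_(s in itv_t) (lam (t - s)%R)%:E - \int[dGe]_(s in itv_t) phi (t - s)%R)%E.
  rewrite -(integralB (mI _) lam_int_dGe phi_int_dGe).
  by apply: eq_integral => s /[!inE] /rev_ge0 st; exact: HE.
have phi_fin := integrable_fin_num (mI _) phi_int_dGe.
have diff_def : (\int[dGe]_(s in itv_t) (lam (t - s)%R)%:E +?
    - \int[dGe]_(s in itv_t) phi (t - s)%R)%E.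
  by apply: fin_num_adde_defl; rewrite fin_numN; exact: phi_fin.
have muV_fin : ((mu%:num^-1)%:E \is a fin_num)%E by [].
rewrite (muleBr muV_fin diff_def).
rewrite lam_dGe phi_dGe.
exact: (ereal_balance tailE tailL tailA balance_conv service (bal t t0)).
Qed.
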